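(* Fix a positive integer $m$. Let $\eta=(1^m)$ and let $\lambda=(\lambda_1,\dots,\lambda_k)$ be a partition. Then $$\langle \eta^{so}|\underline{\lambda}^{so}\rangle=\begin{cases}(-1)^{\frac{|\lambda|+\operatorname{rk}\lambda-\delta-m}{2}+m\operatorname{rk}\lambda} & \text{if }\lambda=(\alpha+2m,m-\delta|\alpha,0)\text{ with }\delta\in\{0,1\},\\ 0 & \text{otherwise,}\end{cases}$$ $$\langle \eta^{sp}|\underline{\lambda}^{sp}\rangle=\begin{cases}(-1)^{\frac{|\lambda|-m}{2}+m\operatorname{rk}\lambda} & \text{if }\lambda=(\alpha+2m+1,m+1|\alpha,0)\text{ or }\lambda=(\alpha+2m+1,m-1|\alpha,0),\\ 0 & \text{otherwise,}\end{cases}$$ $$\langle \eta^{o}|\underline{\lambda}^{o}\rangle=\begin{cases}(-1)^{\frac{|\lambda|-m}{2}+m\operatorname{rk}\lambda} & \text{if }\lambda=(\alpha+2m-1,m-1|\alpha,0),\\ 0 & \text{otherwise.}\end{cases}$$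
   Context: Let $\mathcal{H}$ be the Heisenberg algebra generated by $a_n$, $n\in\mathbb{Z}\setminus\{0\}$, with $[a_m,a_n]=m\delta_{m,-n}$. The Fock space $\mathcal{M}$ is generated by the vacuum $|0\rangle$ with $a_n|0\rangle=0$ for $n>0$, so it has basis given by monomials in $a_{-1},a_{-2},\dots$ applied to $|0\rangle$. The dual vacuum $\langle 0|$ satisfies $\langle 0|a_{-n}=0$ for $n>0$ and $\langle0|0\rangle=1$; i.e. for $v\in\mathcal{M}$, $\langle 0|v\rangle$ is the coefficient of $|0\rangle$ in $v$. Define operators $U^*_n,Y^*_n,W^*_n$ ($n\in\mathbb{Z}$) on $\mathcal{M}$ by the generating series $$E^*(z)=\exp\Big(-\sum_{n\ge1}\frac{a_{-n}}{n}z^n\Big)\exp\Big(\sum_{n\ge1}\frac{a_n}{n}(z^{-n}+z^n)\Big),$$ $$\sum_{n\in\mathbb{Z}}U^*_nz^n=(1-z)E^*(z),\qquad \sum_{n\in\mathbb{Z}}Y^*_nz^n=(1-z^2)E^*(z),\qquad \sum_{n\in\mathbb{Z}}W^*_nz^n=E^*(z).$$ For $\lambda=(\lambda_1,\dots,\lambda_k)$ put $$|\underline{\lambda}^{so}\rangle=U^*_{\lambda_1}\cdots U^*_{\lambda_k}|0\rangle,\quad |\underline{\lambda}^{sp}\rangle=Y^*_{\lambda_1}\cdots Y^*_{\lambda_k}|0\rangle,\quad |\underline{\lambda}^{o}\rangle=W^*_{\lambda_1}\cdots W^*_{\lambda_k}|0\rangle,$$ and for $\mu=(\mu_1,\dots,\mu_l)$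 put $$\langle\mu^{so}|=\langle0|U^*_{-\mu_l}\cdots U^*_{-\mu_1},\quad \langle\mu^{sp}|=\langle0|Y^*_{-\mu_l}\cdots Y^*_{-\mu_1},\quad \langle\mu^{o}|=\langle0|W^*_{-\mu_l}\cdots W^*_{-\mu_1}.$$ Thus e.g. $\langle\eta^{sp}|\underline{\lambda}^{sp}\rangle=\langle 0|(Y^*_{-1})^mY^*_{\lambda_1}\cdots Y^*_{\lambda_k}|0\rangle$, where $(1^m)$ is the partition with $m$ parts equal to $1$. Frobenius notation: $\operatorname{rk}\lambda$ is the largest $r$ with $\lambda_r\ge r$, and $\lambda=(\alpha_1,\dots,\alpha_r|\beta_1,\dots,\beta_r)$ with $r=\operatorname{rk}\lambda$, $\alpha_i=\lambda_i-i$, $\beta_i=\lambda'_i-i$ ($\lambda'$ the conjugate partition). For integers $c,d$, $(\alpha+c,d|\alpha,0)$ denotes $(\alpha_1+c,\dots,\alpha_{r-1}+c,d\,|\,\alpha_1,\dots,\alpha_{r-1},0)$ with $r\ge1$ and $\alpha_1>\dots>\alpha_{r-1}>0$ ($\alpha$ possibly empty). $|\lambda|$ is the sum of the parts. *)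

(* Defs.v *)
From HB Require Import structures.
From mathcomp Require Import all_boot all_order all_algebra.
From mathcomp Require Import boolp classical_sets cardinality fsbigop.

Set Implicit Arguments.
Unset Strict Implicit.
Unset Printing Implicit Defensive.

Import Order.TTheory GRing.Theory.
Local Open Scope classical_set_scope.
Local Open Scope ring_scope.

Section Fock.
Variables (F : fieldType) (M : lmodType F).
Variables (a : int -> {linear M -> M}) (vac : M).
Implicit Types (v : M) (n i : int).

(* a_{-n_1} ... a_{-n_l} |0> *)
Definition fock_monomial (s : seq nat) : M :=
  foldr (fun (p : nat) v => a (- p%:Z) v) vac s.

(* The Heisenberg generators are the [a n] with [n != 0]; nothing is assumed
   about [a 0], and no definition below uses it.  Since the creation operators
   commute, each monomial is listed once, by its nonincreasing sequence of
   positive indices. *)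
Record fock_space : Prop := FockSpace {
  heisenberg_comm : forall m n v, m != 0 -> n != 0 ->
    a m (a n v) - a n (a m v) = (if m == - n then m%:~R else 0) *: v;
  vac_annihilated : forall n, 0 < n -> a n vac = 0;
  monomials_span : forall v, exists (S : seq (seq nat)) (c : seq nat -> F),
    all (fun s => sorted geq s && (0%N \notin s)) S /\
    v = \sum_(s <- S) c s *: fock_monomial s;
  monomials_free : forall (S : seq (seq nat)) (c : seq nat -> F),
    uniq S -> all (fun s => sorted geq s && (0%N \notin s)) S ->
    \sum_(s <- S) c s *: fock_monomial s = 0 -> {in S, forall s, c s = 0}
}.

(* On a Fock space these conditions say that [phi v] is the coefficient of
   [vac] in the monomial expansion of [v]. *)
Definition dual_vacuum (phi : {linear M -> F^o}) : Prop :=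
  phi vac = 1 /\ forall n v, 0 < n -> phi (a (- n) v) = 0.

(* The coefficient of z^n in exp(\sum_i X_i z^i), applied to [v]: expanding
   \sum_l (\sum_i X_i z^i)^l / l! gives one term for each finite sequence
   (i_1, ..., i_l) with i_1 + ... + i_l = n.  The sum [\sum_(s \in A)] is 0 by
   convention when infinitely many terms are nonzero; this does not happen for
   the two exponents below on a Fock space. *)
Definition exp_coef (X : int -> M -> M) n v : M :=
  \sum_(s \in [set s : seq int | \sum_(i <- s) i = n])
     ((size s)`!%:R)^-1 *: foldr X v s.

(* - \sum_(n >= 1) a_{-n} z^n / n *)
Definition creation_exponent i v : M :=
  if 0 < i then - (i%:~R^-1 *: a (- i) v) else 0.

(* \sum_(n >= 1) a_n (z^{-n} + z^n) / n *)
Definition annihilation_exponent i v : M :=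
  if i == 0 then 0 else `|i|%:~R^-1 *: a `|i| v.

Definition Estar n v : M :=
  \sum_(i \in [set: int])
     exp_coef creation_exponent (n - i) (exp_coef annihilation_exponent i v).

Definition Ustar n v : M := Estar n v - Estar (n - 1) v.
Definition Ystar n v : M := Estar n v - Estar (n - 2) v.
Definition Wstar n v : M := Estar n v.

(* X_{la_1} ... X_{la_k} |0> *)
Definition ket (X : int -> M -> M) (la : seq nat) : M :=
  foldr (fun (p : nat) v => X p%:Z v) vac la.

(* <0| X_{-mu_l} ... X_{-mu_1} *)
Definition bra (X : int -> M -> M) (phi : M -> F) (mu : seq nat) (v : M) : F :=
  phi (foldl (fun v (p : nat) => X (- p%:Z) v) v mu).

End Fock.

(* Parts are indexed from 0 in sequences and from 1 in Frobenius notation. *)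
Definition part (la : seq nat) (i : nat) : nat := nth 0%N la i.-1.
Definition conj_part (la : seq nat) (i : nat) : nat := count (leq i) la.

Definition rk (la : seq nat) : nat :=
  (\max_(1 <= r < (size la).+1 | r <= part la r) r)%N.

Definition arms (la : seq nat) : seq nat :=
  [seq (part la i - i)%N | i <- iota 1 (rk la)].
Definition legs (la : seq nat) : seq nat :=
  [seq (conj_part la i - i)%N | i <- iota 1 (rk la)].

(* la = (al + c, d | al, 0) *)
Definition frobenius_form (c d : nat) (la : seq nat) : Prop :=
  exists al : seq nat,
    [/\ sorted gtn al, all (leq 1) al,
        arms la = rcons [seq (x + c)%N | x <- al] d &
        legs la = rcons al 0%N].

(* Main.v *)
(* The operators X = U*, Y*, W* all satisfy
     X_p X_q = - X_{q-1} X_{p+1},  X_n|0> = 0 for n < 0,  X_0|0> = |0>,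
     <0|X_n = eps <0|X_{c-n}
   with (c, eps) = (1, -1), (2, -1), (0, 1) respectively.  In the coordinates
   x_j = n_j - j (j >= 0) the number <0|X_{n_0} X_{n_1} ... X_{n_{N-1}}|0> is thus
   antisymmetric, and is multiplied by eps when some x_j is reflected to c - x_j.
   It vanishes unless permutations and reflections carry the x_j to
   0, -1, ..., -(N-1), since otherwise two coordinates get equal or some X_n with
   n < 0 can be moved next to |0>.  For <eta|la> with k >= 2 parts, the value
   -(N-1) can only come from a last part 0, which may be dropped, or from a first
   part c + 2m + k - 1; reflecting this first coordinate and moving it to the end
   removes the first hook of la, which is how Frobenius notation enters.
   The relations follow from E*(z) = A(z) B(z), where A and B are the creation and
   annihilation exponentials, B(z) = B(1/z), and the exchange of B(z) and A(w). *)

From HB Require Import structures.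
Require Import Defs.
From mathcomp Require Import all_boot all_order all_algebra.
From mathcomp Require Import boolp classical_sets functions cardinality fsbigop.
From mathcomp Require Import zify ring.

Set Implicit Arguments.
Unset Strict Implicit.
Unset Printing Implicit Defensive.

Import Order.TTheory GRing.Theory Num.Theory.
Local Open Scope ring_scope.

(** * Frobenius notation *)

Section Frobenius.
Implicit Types (la l al : seq nat) (p r c d i j : nat).

Lemma leq_part la i j : sorted geq la -> (i <= j)%N -> (part la j <= part la i)%N.
Proof.
move=> la_sorted ij; have [la_j|j_la] := leqP (size la) j.-1.
  by rewrite /part nth_default.
have geq_tr : transitive geq by move=> x y z; lia.
apply: (sorted_leq_nth geq_tr _ 0%N la_sorted); rewrite ?inE; try lia.
by move=> x; apply: leqnn.
Qed.

(** Since the parts decrease, the positive [r] with [r <= part la r] form an initial segment, so a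
    bound on the maximum in [rk] becomes a test at [r] alone. *)
Lemma leq_rk la r : sorted geq la -> (0 < r)%N -> (r <= rk la)%N = (r <= part la r)%N.
Proof.
move=> la_sorted r0; apply/idP/idP => [|r_part].
  apply: contraTT; rewrite -!ltnNge => part_r; rewrite -(ltn_predK r0) ltnS.
  apply/bigmax_leqP_seq => k _ k_part; rewrite -ltnS (ltn_predK r0) ltnNge.
  by apply/negP => rk_; have := leq_part la_sorted rk_; lia.
apply: leq_bigmax_seq; rewrite ?mem_index_iota // r0 ltnS leqNgt.
by apply: contraTN r_part => la_r; rewrite /part nth_default -?ltnNge //; lia.
Qed.

Lemma sorted_rcons0 la : sorted geq (rcons la 0%N) = sorted geq la.
Proof. by case: la => //= p l; rewrite rcons_path andbT. Qed.

Lemma part_rcons0 la i : part (rcons la 0%N) i = part la i.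
Proof.
rewrite /part nth_rcons; case: ltnP => // la_i.
by rewrite nth_default //; case: ifP.
Qed.

Lemma rk_rcons0 la : sorted geq la -> rk (rcons la 0%N) = rk la.
Proof.
move=> la_sorted; apply/eqP; rewrite eqn_leq; apply/andP; split.
  have [->//|r0] := posnP (rk (rcons la 0%N)).
  by rewrite leq_rk // -part_rcons0 -leq_rk // sorted_rcons0.
have [->//|r0] := posnP (rk la).
by rewrite leq_rk ?sorted_rcons0 // part_rcons0 -leq_rk.
Qed.

Lemma arms_rcons0 la : sorted geq la -> arms (rcons la 0%N) = arms la.
Proof.
by move=> la_sorted; rewrite /arms rk_rcons0 //; apply: eq_map => i; rewrite part_rcons0.
Qed.

Lemma legs_rcons0 la : sorted geq la -> legs (rcons la 0%N) = legs la.
Proof.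
move=> la_sorted; rewrite /legs rk_rcons0 //; apply/eq_in_map => i.
rewrite mem_iota /conj_part -cats1 count_cat /= => i1.
by rewrite (_ : (i <= 0)%N = false) ?addn0 //; lia.
Qed.

Lemma frobenius_form_rcons0 c d la : sorted geq la ->
  frobenius_form c d (rcons la 0%N) <-> frobenius_form c d la.
Proof. by move=> la_sorted; rewrite /frobenius_form arms_rcons0 // legs_rcons0. Qed.

Lemma sorted_predn l : sorted geq l -> sorted geq (map predn l).
Proof.
by apply: homo_sorted => x y; rewrite /geq /=; lia.
Qed.

(** * Removal of the first row and first column of a partition *)

Section FirstHook.
Variables (p : nat) (l : seq nat).
Hypotheses (l_sorted : sorted geq (p :: l)) (p_gt0 : (0 < p)%N).
Let l' := map predn l.

Let l'_sorted : sorted geq l'.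
Proof. exact/sorted_predn/path_sorted/l_sorted. Qed.

Lemma part_hook i : (0 < i)%N -> part l' i = (part (p :: l) i.+1).-1.
Proof.
case: i => // i _; rewrite /part /=; have [il|li] := ltnP i (size l).
  by rewrite (nth_map 0%N).
by rewrite !nth_default ?size_map.
Qed.

(** A natural number is determined by the numbers it bounds, so the ranks are compared threshold by
    threshold through [leq_rk]. *)
Lemma rk_hook : rk (p :: l) = (rk l').+1.
Proof.
have rk_le r : (r <= rk (p :: l))%N = (r <= (rk l').+1)%N.
  case: r => [//|[|r]]; first by rewrite leq_rk.
  by rewrite leq_rk // ltnS leq_rk // part_hook //; lia.
by apply/eqP; rewrite eqn_leq -rk_le leqnn rk_le leqnn.
Qed.

Lemma arms_hook : arms (p :: l) = p.-1 :: arms l'.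
Proof.
rewrite /arms rk_hook /= -subn1; congr (_ :: _).
rewrite -[2%N]addn1 iotaDl -map_comp; apply/eq_in_map => i.
by rewrite mem_iota /= !add1n => i1; rewrite part_hook; lia.
Qed.

(** Without zero parts, every entry of [l] lies below the corner. For the later legs, the first row
    reaches column [i.+1], and the box it contributes offsets the shift of the index. *)
Lemma legs_hook : 0%N \notin l -> legs (p :: l) = size l :: legs l'.
Proof.
move=> l0; rewrite /legs rk_hook /=; congr (_ :: _).
  rewrite /conj_part /= p_gt0 add1n subn1 /=; apply/eqP; rewrite -all_count.
  by apply/allP => q ql; rewrite lt0n; apply: contraNneq l0 => <-.
rewrite -[2%N]addn1 iotaDl -map_comp; apply/eq_in_map => i.
rewrite mem_iota /= !add1n => /andP[i1 i_rk].
have : (i.+1 <= p)%N.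
  have := leq_part l_sorted (leq0n i.+1); rewrite {2}/part /=.
  have : (i <= rk l')%N by lia.
  by rewrite leq_rk // part_hook //; lia.
rewrite /conj_part /= => ->; rewrite add1n subSS; congr (_ - _)%N.
by rewrite count_map; apply: eq_count => q /=; lia.
Qed.

Lemma sumn_hook : 0%N \notin l -> sumn (p :: l) = (p + size l + sumn l')%N.
Proof.
rewrite /= -addnA => l0; congr (_ + _)%N; rewrite /l'.
by elim: l l0 => //= q s IHs; rewrite inE negb_or => /andP[q0 /IHs ->]; lia.
Qed.

End FirstHook.

Lemma rk_nil : rk [::] = 0%N.
Proof. by rewrite /rk big_geq. Qed.

Lemma frobenius_form_nil c d : ~ frobenius_form c d [::].
Proof. by case=> al [_ _]; rewrite /arms rk_nil /=; case: al. Qed.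

Lemma frobenius_form1 c d p : (0 < p)%N -> frobenius_form c d [:: p] <-> d = p.-1.
Proof.
move=> p0; rewrite /frobenius_form arms_hook // legs_hook //= /arms /legs rk_nil /=.
split=> [[[|q al] [_ _]]|->]; first by case.
  by case: al.
by exists [::].
Qed.

Lemma legs_lt_size la i : i \in legs la -> (i < size la)%N.
Proof.
case: la => [|q la]; first by rewrite /legs rk_nil.
case/mapP => j; rewrite mem_iota => /andP[j1 _] ->.
have := count_size (leq j) (q :: la); rewrite /conj_part /=; lia.
Qed.

(** The first hook has arm [p.-1] and leg [size l]. As [l] is nonempty this leg is positive, so it
    heads [al] and the arm must exceed it by [c]; the other arms and legs are those of
    [map predn l]. *)
Lemma frobenius_form_hook c d p l : sorted geq (p :: l) -> (0 < p)%N ->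
    0%N \notin l -> l != [::] ->
  frobenius_form c d (p :: l) <-> p = (c + size l).+1 /\ frobenius_form c d (map predn l).
Proof.
move=> l_sorted p0 l0 l_nil; rewrite /frobenius_form arms_hook // legs_hook //.
have l_gt0 : (0 < size l)%N by rewrite lt0n size_eq0.
split=> [[[|q al] []] /=|[-> [al [al_sorted al_pos arms_l legs_l]]]].
- by move=> _ _ _ [l_eq0]; lia.
- move=> al_sorted /andP[q0 al_pos] [pq arms_l] [lq legs_l]; split; first by lia.
  by exists al; split => //; apply: path_sorted al_sorted.
exists (size l :: al); split => /=; last by rewrite legs_l.
- case: al al_sorted {al_pos arms_l} legs_l => //= q al -> legs_l; rewrite andbT.
  (* Prepending [size l] keeps [al] strictly decreasing because each leg of [map predn l] is smaller
     than its number of rows. *)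
  by have := @legs_lt_size (map predn l) q; rewrite legs_l mem_head size_map => ->.
- by rewrite l_gt0.
- by rewrite arms_l addnC.
Qed.

(** Dropping a final zero and removing the first hook both shorten the sequence by one, so induction
    on the length applies; by monotonicity a sequence containing zero ends in zero. *)
Lemma partition_ind (P : seq nat -> Prop) :
    P [::] -> (forall l, sorted geq l -> P l -> P (rcons l 0%N)) ->
    (forall p l, sorted geq (p :: l) -> (0 < p)%N -> 0%N \notin l ->
       P (map predn l) -> P (p :: l)) ->
  forall la, sorted geq la -> P la.
Proof.
move=> Pnil P0 Phook la; have [n] := ubnP (size la).
elim: n la => // n IHn la la_n la_sorted; have [la0|] := boolP (0%N \in la).
  case/lastP: la => // l q in la_n la_sorted la0 *.
  have q0 : q = 0%N.
    have := leq_part (i := (index 0%N (rcons l q)).+1) (j := (size l).+1) la_sorted.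
    rewrite /part /= nth_index // nth_rcons ltnn eqxx.
    by move: la0; rewrite -index_mem size_rcons ltnS => li /(_ li); lia.
  rewrite q0 in la_sorted *; rewrite sorted_rcons0 in la_sorted.
  by apply: P0 => //; apply: IHn => //; rewrite size_rcons in la_n.
case: la => // p l in la_n la_sorted *; rewrite inE negb_or => /andP[p0 l0].
apply: Phook => //; first by lia.
by apply: IHn; [rewrite size_map | apply/sorted_predn/path_sorted/la_sorted].
Qed.

Lemma sumn_arms_legs la : sorted geq la ->
  sumn la = (sumn (arms la) + sumn (legs la) + rk la)%N.
Proof.
move: la; apply: partition_ind => [|l l_sorted IHl|p l l_sorted p0 l0 IHl].
- by rewrite /arms /legs rk_nil.
- by rewrite sumn_rcons addn0 arms_rcons0 // legs_rcons0 // rk_rcons0.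
by rewrite sumn_hook // arms_hook // legs_hook // rk_hook //= IHl; lia.
Qed.

(** All arms but the last exceed the matching leg by [c], so the legs are counted twice. This parity
    is what makes the halved exponents of the final formulas exact. *)
Lemma sumn_frobenius_form c d la : sorted geq la -> frobenius_form c d la ->
  (0 < rk la)%N /\ sumn la = (2 * sumn (legs la) + c.+1 * (rk la).-1 + d.+1)%N.
Proof.
move=> la_sorted [al [_ _ arms_la legs_la]].
have rk_la : rk la = (size al).+1.
  by rewrite -(size_iota 1 (rk la)) -(size_map (fun i => conj_part la i - i)%N)
     -/(legs la) legs_la size_rcons.
rewrite (sumn_arms_legs la_sorted) arms_la legs_la rk_la !sumn_rcons; split=> //=.
have -> : sumn [seq (x + c)%N | x <- al] = (sumn al + c * size al)%N.
  by elim: al {arms_la legs_la rk_la} => [|x al IHal] /=; rewrite ?muln0 // IHal mulnS; lia.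
by rewrite mulSn; lia.
Qed.

End Frobenius.

(** * Vacuum expectations from exchange and reflection relations *)

Section Reflection.
Variables (F : fieldType) (M : lmodType F) (X : int -> {linear M -> M}) (vac : M).
Variables (phi : {linear M -> F^o}) (c : nat) (eps : F).
Hypotheses (F0 : [pchar F] =i pred0) (c_le2 : (c <= 2)%N).
Hypotheses (eps_neq0 : eps != 0) (eps_c2 : c = 2%N -> eps = -1).
Hypothesis X_anticomm : forall p q v, X p (X q v) = - X (q - 1) (X (p + 1) v).
Hypothesis X_flip : forall n v, phi (X n v) = eps * phi (X (c%:Z - n) v).
Hypotheses (X_neg_vac : forall n, n < 0 -> X n vac = 0) (X_0_vac : X 0 vac = vac).
Hypothesis phi_vac : phi vac = 1.
Implicit Types (v : M) (t x y : int) (s : seq int).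

(* X_{x_0 + t} X_{x_1 + t + 1} ... v: in these coordinates the exchange relation
   is antisymmetry. *)
Fixpoint act t s v := if s is x :: s' then X (x + t) (act (t + 1) s' v) else v.

Definition pairing s := phi (act 0 s vac).

Lemma act_cons t x s v : act t (x :: s) v = X (x + t) (act (t + 1) s v).
Proof. by []. Qed.

Lemma act_is_linear t s : linear (act t s).
Proof. by elim: s t => [|x s IHs] t k u v //=; rewrite IHs linearP. Qed.

HB.instance Definition _ t s := GRing.isLinear.Build F M M *:%R (act t s) (act_is_linear t s).

Lemma act_cat t s1 s2 v : act t (s1 ++ s2) v = act t s1 (act (t + (size s1)%:Z) s2 v).
Proof.
elim: s1 t => [|x s1 IHs1] t /=; first by rewrite addr0.
by rewrite IHs1 (_ : t + 1 + (size s1)%:Z = t + (size s1).+1%:Z) //; lia.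
Qed.

Lemma act_swap t x y s v : act t [:: x, y & s] v = - act t [:: y, x & s] v.
Proof.
rewrite /= X_anticomm (_ : y + (t + 1) - 1 = y + t); last by lia.
by rewrite (_ : x + t + 1 = x + (t + 1)) //; lia.
Qed.

Lemma act_front t x s1 s2 v :
  act t (s1 ++ x :: s2) v = (-1) ^+ size s1 *: act t (x :: s1 ++ s2) v.
Proof.
elim: s1 t => [|y s1 IHs1] t; first by rewrite scale1r.
rewrite cat_cons [LHS]act_cons IHs1 linearZZ -[X _ _]act_cons act_swap.
by rewrite exprS mulN1r scaleNr scalerN.
Qed.

Lemma act_perm t s1 s2 v : perm_eq s1 s2 ->
  exists n, act t s1 v = (-1) ^+ n *: act t s2 v.
Proof.
elim: s1 s2 t => [|x s1 IHs1] s2 t.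
  by rewrite perm_sym => /perm_nilP->; exists 0%N; rewrite scale1r.
move=> s12; have x_s2 : x \in s2 by rewrite -(perm_mem s12) mem_head.
case/splitPr: x_s2 s12 => [u1 u2]; rewrite perm_sym perm_catC /= perm_cons perm_catC perm_sym.
move/(IHs1 _ (t + 1)) => [n u12]; exists (n + size u1)%N.
rewrite act_front scalerA exprD -mulrA -expr2 sqrr_sign mulr1 /=.
by rewrite u12 linearZ.
Qed.

Lemma pairing_front x s1 s2 :
  pairing (s1 ++ x :: s2) = (-1) ^+ size s1 * pairing (x :: s1 ++ s2).
Proof. by rewrite /pairing act_front linearZ. Qed.

Lemma pairing_back x s : pairing (x :: s) = (-1) ^+ size s * pairing (rcons s x).
Proof. by rewrite -cats1 pairing_front cats0 mulrA -expr2 sqrr_sign mul1r. Qed.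

Lemma pairing_perm s1 s2 : perm_eq s1 s2 -> (pairing s1 == 0) = (pairing s2 == 0).
Proof.
move=> s12; have [n E] := act_perm 0 vac s12.
by rewrite /pairing E linearZ /= mulf_eq0 signr_eq0.
Qed.

Let two_neq0 : 2%:R != 0 :> F.
Proof. by rewrite ((pcharf0P F).1 F0). Qed.

(** Once the two equal entries are adjacent, their exchange gives [w = - w], and 2 is invertible. *)
Lemma act_dup t s v : ~~ uniq s -> act t s v = 0.
Proof.
elim: s t => //= x s IHs t; rewrite negb_and negbK => /orP[x_s|/IHs->]; last exact: linear0.
case/splitPr: x_s => s1 s2; rewrite act_front linearZZ -act_cons.
set w := act _ _ _; suff -> : w = 0 by rewrite scaler0.
have wN : w = - w by rewrite {1}/w act_swap.
apply: (scalerI two_neq0); rewrite scaler0 scaler_nat mulr2n {1}wN; exact: addNr.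
Qed.

(** At the front the operator index equals the coordinate, so [X_flip] applies there; the signs of
    moving forth and back cancel. *)
Lemma pairing_flip x s1 s2 :
  pairing (s1 ++ x :: s2) = eps * pairing (s1 ++ (c%:Z - x) :: s2).
Proof.
by rewrite !(pairing_front _ s1) mulrCA /pairing /= !addr0 X_flip.
Qed.

Lemma pairing_last s x : x < - (size s)%:Z -> pairing (rcons s x) = 0.
Proof.
move=> xs; rewrite /pairing -cats1 act_cat /= add0r X_neg_vac ?linear0 //; lia.
Qed.

Lemma pairing_last0 s : pairing (rcons s (- (size s)%:Z)) = pairing s.
Proof. by rewrite /pairing -cats1 act_cat /= add0r addNr X_0_vac. Qed.

(** Moved to the end, [x] becomes an operator of index [x + size s - 1 < 0] acting on the vacuum. *)
Lemma pairing_small s x : x \in s -> x <= - (size s)%:Z -> pairing s = 0.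
Proof.
move=> xs; rewrite (perm_size (perm_to_rem xs)) => s_small; apply/eqP.
rewrite (pairing_perm (perm_to_rem xs)) pairing_back pairing_last ?mulr0 //.
by move: s_small => /=; lia.
Qed.

(* The nonpositive representative of x under x -> c - x, except that 1 is fixed when c = 2. *)
Let fold x := Num.min x (c%:Z - x).

Lemma pairing_fold s : (pairing s == 0) = (pairing (map fold s) == 0).
Proof.
suff fold_cat s1 s2 : (pairing (s1 ++ s2) == 0) = (pairing (s1 ++ map fold s2) == 0).
  exact: fold_cat [::] s.
elim: s2 s1 => // x s2 IHs2 s1 /=.
transitivity (pairing (s1 ++ fold x :: s2) == 0); last by rewrite -!cat_rcons IHs2.
rewrite /fold minEle; case: ifP => // _.
by rewrite pairing_flip mulf_eq0 (negbTE eps_neq0).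
Qed.

Lemma fold_ge s x : pairing s != 0 -> x \in s -> - (size s)%:Z < fold x.
Proof.
rewrite pairing_fold => s0 xs; rewrite ltNge; apply: contraNN s0 => x_small.
by apply/eqP/(pairing_small (map_f fold xs)); rewrite size_map.
Qed.

(** As [c <= 2], only the fixed point 1 of x -> 2 - x folds to a positive value, and there
    [pairing_flip] with [eps = -1] makes the pairing its own opposite. *)
Lemma fold_le0 s x : pairing s != 0 -> x \in s -> fold x <= 0.
Proof.
move=> s0 xs; have [//|fx] := leP (fold x) 0.
have [c2 x1] : c = 2%N /\ x = 1 by move: fx; rewrite /fold; lia.
case/splitPr: xs s0 => s1 s2; rewrite x1 => /eqP[]; apply/eqP.
have := pairing_flip 1 s1 s2; rewrite eps_c2 // c2 mulN1r => /eqP.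
by rewrite -subr_eq0 opprK -mulr2n -mulr_natl mulf_eq0 (negbTE two_neq0).
Qed.

(** Pigeonhole: the N = [size s] folded coordinates are distinct and lie among 0, -1, ..., -(N-1),
    so each of these values occurs, and -i is the fold of -i or of c + i only. *)
Lemma pairing_cover s i : pairing s != 0 -> (i < size s)%N ->
  (- i%:Z \in s) || (c%:Z + i%:Z \in s).
Proof.
move=> s0 i_s; pose r := [seq - (j%:Z) | j <- iota 0 (size s)].
have s_sub : {subset map fold s <= r}.
  move=> _ /mapP[x xs ->]; have := fold_ge s0 xs; have := fold_le0 s0 xs.
  by move=> x0 sx; apply/mapP; exists `|fold x|%N; rewrite ?mem_iota; lia.
have s_uniq : uniq (map fold s).
  apply: contraNT s0 => dup; rewrite pairing_fold /pairing act_dup //; exact/eqP/linear0.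
have [|_ sr] := uniq_min_size s_uniq s_sub; first by rewrite !size_map size_iota.
have : - i%:Z \in map fold s by rewrite sr; apply: map_f; rewrite mem_iota.
case/mapP => x xs; rewrite /fold minEle; case: ifP => _ E; first by rewrite E xs.
by rewrite (_ : c%:Z + i%:Z = x) ?xs ?orbT //; lia.
Qed.

Lemma pairing_range s x : pairing s != 0 -> x \in s ->
  - (size s)%:Z < x < c%:Z + (size s)%:Z.
Proof. by move=> s0 xs; have := fold_ge s0 xs; rewrite /fold; lia. Qed.

(** * Pairings of the column (1^m) with a partition, in shifted coordinates *)

Fixpoint shift t (ns : seq int) := if ns is n :: ns' then n - t :: shift (t + 1) ns' else [::].

Lemma act_shift t ns v : act t (shift t ns) v = foldr (fun n => X n) v ns.
Proof. by elim: ns t => //= n ns IHns t; rewrite IHns subrK. Qed.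

Lemma size_shift t ns : size (shift t ns) = size ns.
Proof. by elim: ns t => //= n ns IHns t; rewrite IHns. Qed.

Lemma shift_cat t ns1 ns2 :
  shift t (ns1 ++ ns2) = shift t ns1 ++ shift (t + (size ns1)%:Z) ns2.
Proof.
elim: ns1 t => [|n ns1 IHns1] t /=; first by rewrite addr0.
by rewrite IHns1 (_ : t + 1 + (size ns1)%:Z = t + (size ns1).+1%:Z) //; lia.
Qed.

Lemma shiftD t k ns : shift (t + k) ns = shift t (map (fun n => n - k) ns).
Proof.
elim: ns t => //= n ns IHns t; rewrite addrAC IHns.
by rewrite (_ : n - (t + k) = n - k - t) //; lia.
Qed.

Lemma mem_shift t ns x : x \in shift t ns ->
  exists2 j, (j < size ns)%N & x = ns`_j - t - j%:Z.
Proof.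
elim: ns t => //= n ns IHns t; rewrite inE => /orP[/eqP->|/IHns[j js ->]].
  by exists 0%N => //=; rewrite subr0.
by exists j.+1 => //=; lia.
Qed.

Definition braket (m : nat) (la : seq nat) : F :=
  phi (foldr (fun n => X n) vac (nseq m (-1) ++ map Posz la)).

Lemma braketE m la :
  braket m la = pairing (shift 0 (nseq m (-1)) ++ shift m%:Z (map Posz la)).
Proof.
by rewrite /braket -(act_shift 0) shift_cat size_nseq add0r.
Qed.

Lemma braket_rcons0 m la : braket m (rcons la 0%N) = braket m la.
Proof. by rewrite /braket map_rcons -rcons_cat -cats1 foldr_cat /= X_0_vac. Qed.

(** The coordinate of [p] is c + m + [size l]; its reflection is the value that acts as [X 0] on the
    vacuum at the last place. Taking it out moves the entries of [l] one place forward, which lowers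
    each part by one at fixed coordinates. *)
Lemma braket_hook m p l : (p = c + 2 * m + size l)%N -> 0%N \notin l ->
  braket m (p :: l) = (-1) ^+ size l * eps * braket m (map predn l).
Proof.
move=> pE l0; rewrite !braketE /=; set s1 := shift 0 _; set s2 := shift (m%:Z + 1) _.
have -> : shift m%:Z (map Posz (map predn l)) = s2.
  rewrite /s2 shiftD; congr shift; rewrite -!map_comp; apply/eq_in_map => q ql /=.
  (* Truncated [predn] agrees with subtraction of 1 in the integers only on nonzero parts. *)
  have : q != 0%N by apply: contraNneq l0 => <-.
  lia.
have s12 : size (s1 ++ s2) = (m + size l)%N.
  by rewrite size_cat !size_shift size_nseq size_map.
rewrite pairing_flip pairing_front pairing_back s12.
rewrite (_ : c%:Z - _ = - (size (s1 ++ s2))%:Z) ?pairing_last0; last by rewrite s12; lia.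
(* The moved coordinate crosses the [m] bra entries twice, so their signs cancel and only those of
   [l] remain. *)
rewrite size_shift size_nseq exprD; have := sqrr_sign F m.
by move: ((-1) ^+ m) => e e1; rewrite -[RHS]mul1r -{}e1; ring.
Qed.

Lemma mem_shift_nseq m x : x \in shift 0 (nseq m (-1)) -> - (m%:Z) <= x < 0.
Proof.
case/mem_shift => j; rewrite size_nseq => jm ->.
by rewrite nth_nseq jm; lia.
Qed.

Lemma braket_nil m : (0 < m)%N -> braket m [::] = 0.
Proof.
move=> m0; apply/eqP; rewrite braketE cats0; apply/negP => /negP s0.
have := @pairing_cover _ 0 s0; rewrite size_shift size_nseq => /(_ m0).
by case/orP => /mem_shift_nseq; lia.
Qed.

(** The part [m] has coordinate 0. Moved to the front it precedes -1, ..., -m, and these are the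
    coordinates of m + 1 operators [X 0], which fix the vacuum. *)
Lemma braket_one_part m : braket m [:: m] = (-1) ^+ m.
Proof.
rewrite braketE /= subrr pairing_front size_shift size_nseq cats0.
have -> : 0 :: shift 0 (nseq m (-1)) = shift 0 (nseq m.+1 0).
  rewrite /= subrr add0r (shiftD 0 1); congr (_ :: _); congr shift.
  by rewrite map_nseq.
rewrite /pairing act_shift.
have -> : foldr (fun n => X n) vac (nseq m.+1 0) = vac.
  by elim: m.+1 => //= n ->; rewrite X_0_vac.
rewrite phi_vac; exact: mulr1.
Qed.

Lemma braket_one_part_flip m : braket m [:: c + m]%N = (-1) ^+ m * eps.
Proof.
rewrite braketE /= pairing_flip (_ : c%:Z - _ = m%:Z - m%:Z); last by lia.
by rewrite mulrC -(braket_one_part m) braketE.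
Qed.

Lemma braket_one_part_eq0 m p : (0 < m)%N -> p != m -> p != (c + m)%N -> braket m [:: p] = 0.
Proof.
move=> m0 pm pcm; apply/eqP; rewrite braketE; apply/negP => /negP s0.
have := @pairing_cover _ 0 s0; rewrite size_cat /= addn1 => /(_ isT).
by rewrite !mem_cat !inE => /orP[] /orP[/mem_shift_nseq|/eqP]; lia.
Qed.

(** By [pairing_cover] some coordinate is -(m + [size l]) or c + m + [size l]. The former is too
    small, since the parts are positive and [l] is nonempty; the latter would have to come from
    [p]. *)
Lemma braket_eq0 m p l : (0 < m)%N -> sorted geq (p :: l) -> 0%N \notin l -> l != [::] ->
  p != (c + 2 * m + size l)%N -> braket m (p :: l) = 0.
Proof.
move=> m0 l_sorted l0 l_nil pE; apply/eqP; rewrite braketE; apply/negP => /negP s0.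
have l_gt0 : (0 < size l)%N by rewrite lt0n size_eq0.
set s := _ ++ _ in s0.
have s_size : size s = (m + size l).+1.
  by rewrite size_cat !size_shift size_nseq /= size_map addnS.
have part_gt0 j : (j <= size l)%N -> (0 < nth 0%N (p :: l) j <= p)%N.
  have /allP l_le : all (geq p) l by apply: order_path_min l_sorted => x y z; lia.
  have l_pos q : q \in l -> (0 < q <= p)%N.
    by move=> ql; rewrite lt0n (contraNneq _ l0) ?andTb => [|<-] //; exact: l_le q ql.
  have p0 : (0 < p)%N by have := l_pos _ (mem_nth 0%N l_gt0); lia.
  by case: j => [|j jl] /=; [rewrite p0 leqnn | apply/l_pos/mem_nth].
(* This upper bound on [p] excludes the later parts: reaching the same coordinate from place [j > 0]
   takes a part larger by [j]. *)
have p_le : p%:Z - m%:Z < c%:Z + (size s)%:Z.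
  have ps : p%:Z - m%:Z \in s by rewrite mem_cat mem_head orbT.
  by have /andP[] := pairing_range s0 ps.
have mem_s x : x \in s -> - (m%:Z) <= x < 0 \/
    exists2 j, (j <= size l)%N & x = (nth 0%N (p :: l) j)%:Z - m%:Z - j%:Z.
  rewrite mem_cat => /orP[/mem_shift_nseq|/mem_shift[j]]; first by left.
  by rewrite size_map => js ->; right; exists j; rewrite // (nth_map 0%N).
have := @pairing_cover _ (m + size l) s0; rewrite s_size => /(_ (leqnn _)).
case/orP; first by case/mem_s => [|[j js]]; [lia | have := part_gt0 j js; lia].
by case/mem_s => [|[j js]]; [lia | have := part_gt0 j js; lia].
Qed.

(** Each removed hook contributes [eps] and the sign of its leg, and leaves [d] unchanged. The last
    hook is a single row with arm [d]: the part is [m], or [c + m], which costs one more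
    reflection. *)
Lemma braket_frobenius m la : (0 < m)%N -> sorted geq la ->
  (forall d, d \in [:: m.-1; (m + c).-1] -> frobenius_form (2 * m + c).-1 d la ->
     braket m la = (-1) ^+ (m + sumn (legs la)) * eps ^+ (rk la).-1 *
       (if d == m.-1 then 1 else eps)) /\
  ((forall d, d \in [:: m.-1; (m + c).-1] -> ~ frobenius_form (2 * m + c).-1 d la) ->
     braket m la = 0).
Proof.
move=> m0; move: la; apply: partition_ind => [|l l_sorted [IHform IHnot]|].
- by split=> [d _ /frobenius_form_nil|_] //; apply: braket_nil.
- rewrite braket_rcons0 legs_rcons0 // rk_rcons0 //; split=> [d dm|not_form].
    by rewrite frobenius_form_rcons0 //; apply: IHform.
  by apply: IHnot => d dm; rewrite -frobenius_form_rcons0 //; apply: not_form.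
move=> p l l_sorted p0 l0 [IHform IHnot]; have [->|l_nil] := eqVneq l [::].
  have -> : legs [:: p] = [:: 0%N] by rewrite legs_hook //= /legs rk_nil.
  rewrite rk_hook // rk_nil /= mulr1 !addn0; split=> [d|not_form].
    rewrite !inE => dm /frobenius_form1 => /(_ p0) dp.
    case: eqP dm => [dm _|dm /eqP dmc] /=.
      have -> : p = m by lia.
      by rewrite braket_one_part mulr1.
    have -> : p = (c + m)%N by lia.
    exact: braket_one_part_flip.
  have pN d : d \in [:: m.-1; (m + c).-1] -> d != p.-1.
    by move=> dm; apply/eqP => dp; apply: (not_form d dm); apply/frobenius_form1.
  apply: braket_one_part_eq0 => //.
    by have := pN m.-1; rewrite mem_head => /(_ isT); lia.
  by have := pN (m + c).-1; rewrite !inE eqxx orbT => /(_ isT); lia.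
have hook d := frobenius_form_hook (2 * m + c).-1 d l_sorted p0 l0 l_nil.
have [pE|pN] := eqVneq p (c + 2 * m + size l)%N; last first.
  have c0 : braket m (p :: l) = 0 by apply: braket_eq0.
  by split=> // d dm /hook[pE]; move/eqP: pN; lia.
rewrite (braket_hook pE l0) legs_hook // rk_hook //=; split=> [d dm /hook[_ form]|not_form].
  have [rk0 _] := sumn_frobenius_form (sorted_predn (path_sorted l_sorted)) form.
  rewrite (IHform d dm form); case: (rk _) rk0 => // r _ /=.
  by rewrite exprS !exprD; ring.
by rewrite IHnot ?mulr0 // => d dm form; apply: (not_form d dm); apply/hook; split=> //; lia.
Qed.

(** [bra] applies the entries in the opposite order to a [foldr]; for a constant sequence this makes
    no difference. *)
Lemma bra_ketE m la : bra (fun n => X n) phi (nseq m 1%N) (ket vac (fun n => X n) la) = braket m la.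
Proof.
rewrite /bra /ket /braket foldr_cat foldr_map; congr (phi _).
set v := foldr _ _ _; elim: m v => //= m IHm v; rewrite IHm.
by elim: m {IHm} => //= m ->.
Qed.

End Reflection.

(** * Coefficients of exponentials *)

Definition window (K : nat) : seq int := [seq i%:Z - K%:Z | i <- iota 0 (2 * K).+1].

Lemma mem_window K i : (i \in window K) = (`|i| <= K)%N.
Proof.
apply/mapP/idP => [[j]|iK]; first by rewrite mem_iota => jK ->; lia.
by exists (absz (i + K%:Z)); rewrite ?mem_iota; lia.
Qed.

Lemma window_uniq K : uniq (window K).
Proof. by rewrite map_inj_uniq ?iota_uniq // => i j; lia. Qed.

Section WindowSums.
Variable V : zmodType.
Implicit Types (f : int -> V) (K L : nat).

Lemma fsum_window K f : (forall i, (K < `|i|)%N -> f i = 0) ->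
  \sum_(i \in [set: int]) f i = \sum_(i <- window K) f i.
Proof.
move=> f0; rewrite [RHS](bigfs _ (P := xpredT)) ?window_uniq //.
  by apply: eq_fsbigl; apply/seteqP; split.
by move=> i _; rewrite mem_window -ltnNge; apply: f0.
Qed.

(** Both windows contain the support of their summand, so both sums equal sums over all integers,
    where a bijection may be applied. *)
Lemma reindex_window h K L f : bijective h ->
    (forall i, (K < `|i|)%N -> f (h i) = 0) -> (forall i, (L < `|i|)%N -> f i = 0) ->
  \sum_(i <- window K) f (h i) = \sum_(i <- window L) f i.
Proof.
move=> h_bij fhK fL; rewrite -(fsum_window fhK) -(fsum_window fL).
by rewrite [RHS](reindex_fsbigT h) // setTT_bijective.
Qed.

Lemma sum_window1 K j f : (`|j| <= K)%N -> (forall i, i != j -> f i = 0) ->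
  \sum_(i <- window K) f i = f j.
Proof.
move=> jK f0; rewrite (bigD1_seq j) ?mem_window ?window_uniq //=.
by rewrite big1 ?addr0 // => i /f0.
Qed.

Lemma sum_window2 K j1 j2 f : (`|j1| <= K)%N -> (`|j2| <= K)%N -> j1 != j2 ->
    (forall i, i != j1 -> i != j2 -> f i = 0) ->
  \sum_(i <- window K) f i = f j1 + f j2.
Proof.
move=> j1K j2K j12 f0; rewrite (bigD1_seq j1) ?mem_window ?window_uniq //=.
congr (_ + _); rewrite big_mkcond (bigD1_seq j2) ?mem_window ?window_uniq //=.
rewrite eq_sym j12 big1 ?addr0 // => i i2; case: ifP => // i1; exact: f0.
Qed.

End WindowSums.

Section ExpCoef.
Variables (F : fieldType) (M : lmodType F) (X : int -> {linear M -> M}).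
Implicit Types (v : M) (n i : int) (K l : nat) (s : seq int).

Local Notation Xf := (fun i => X i : M -> M).

(* The coefficient of z^n in (\sum_(|i| <= K) X_i z^i)^l. *)
Fixpoint pow_coef K l n v : M :=
  if l is l'.+1 then \sum_(i <- window K) X i (pow_coef K l' (n - i) v)
  else if n == 0 then v else 0.

Lemma pow_coefS K l n v :
  pow_coef K l.+1 n v = \sum_(i <- window K) X i (pow_coef K l (n - i) v).
Proof. by []. Qed.

Fixpoint box K l : seq (seq int) :=
  if l is l'.+1 then [seq i :: s | i <- window K, s <- box K l'] else [:: [::]].

Lemma mem_box K l s : (s \in box K l) = (size s == l) && all (mem (window K)) s.
Proof.
elim: l s => [|l IHl] s; first by case: s.
rewrite [box _ _]/(allpairs _ _ _); apply/allpairsP/andP => [[[i t] /= [iK]]|].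
  by rewrite IHl => /andP[/eqP <- tK] ->; rewrite /= iK.
case: s => [[]|i s /= [sl /andP[iK sK]]] //.
by exists (i, s); rewrite IHl -eqSS sl sK iK.
Qed.

Lemma box_uniq K l : uniq (box K l).
Proof.
elim: l => [|l IHl] //; apply: allpairs_uniq; rewrite ?window_uniq //.
by move=> [i s] [j t] _ _ [-> ->].
Qed.

(** Expanding the power into words links the recursive [pow_coef], suited to induction, with the sum
    over sequences in [exp_coef]. *)
Lemma pow_coefE K l n v :
  pow_coef K l n v = \sum_(s <- box K l | \sum_(i <- s) i == n) foldr Xf v s.
Proof.
elim: l n => [|l IHl] n.
  by rewrite big_cons !big_nil eq_sym /=; case: eqP; rewrite ?addr0.
rewrite [RHS]big_mkcond big_allpairs_dep; apply: eq_bigr => i _.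
rewrite -/(pow_coef K l _ _) IHl raddf_sum [LHS]big_mkcond; apply: eq_bigr => s _.
rewrite big_cons (_ : (i + _ == n) = (\sum_(j <- s) j == n - i)) //.
apply/eqP/eqP => [<-|->]; first by rewrite addrAC subrr add0r.
by rewrite addrC subrK.
Qed.

Lemma pow_coef_is_linear K l n : linear (pow_coef K l n).
Proof.
elim: l n => [|l IHl] n c u v /=; first by case: eqP; rewrite ?scaler0 ?addr0.
rewrite scaler_sumr -big_split; apply: eq_bigr => i _.
by rewrite IHl linearP.
Qed.

HB.instance Definition _ K l n :=
  GRing.isLinear.Build F M M *:%R (pow_coef K l n) (@pow_coef_is_linear K l n).

Lemma pow_coef_comm (f : {linear M -> M}) K l n v :
    (forall i u, f (X i u) = X i (f u)) ->
  f (pow_coef K l n v) = pow_coef K l n (f v).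
Proof.
move=> fX; elim: l n => [|l IHl] n /=; first by case: eqP; rewrite ?raddf0.
by rewrite linear_sum; apply: eq_bigr => i _; rewrite fX IHl.
Qed.

(* The Euler operator z d/dz is a derivation. *)
Lemma pow_coef_euler K l n v : (forall i j u, X i (X j u) = X j (X i u)) ->
  n%:~R *: pow_coef K l.+1 n v =
    l.+1%:R *: \sum_(i <- window K) i%:~R *: X i (pow_coef K l (n - i) v).
Proof.
move=> XC; elim: l n => [|l IHl] n.
  rewrite scale1r scaler_sumr; apply: eq_bigr => i _ /=.
  by case: eqP; rewrite ?raddf0 ?scaler0 // => /subr0_eq ->.
rewrite pow_coefS.
(* Leibniz rule: [n = i + (n - i)] splits the weight between the first factor and the rest. *)
transitivity (\sum_(i <- window K) i%:~R *: X i (pow_coef K l.+1 (n - i) v) +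
  \sum_(i <- window K) X i ((n - i)%:~R *: pow_coef K l.+1 (n - i) v)).
  rewrite -big_split scaler_sumr; apply: eq_bigr => i _ /=.
  by rewrite linearZ -scalerDl -intrD [i + _]addrC subrK.
rewrite [l.+2%:R]mulrS scalerDl scale1r; congr (_ + _).
under eq_bigr do rewrite IHl linearZ.
rewrite -scaler_sumr; congr (_ *: _).
under eq_bigr => i _ do rewrite raddf_sum.
rewrite exchange_big; apply: eq_bigr => j _ /=.
rewrite raddf_sum scaler_sumr; apply: eq_bigr => i _ /=.
by rewrite linearZ /= XC -!addrA [- i - j]addrC.
Qed.

(** The commutator of the series X(z) with [f] is the scalar series z^k + z^(-k), so commuting [f]
    past a power behaves like differentiating that power. *)
Lemma pow_coef_shift (f : {linear M -> M}) (k : int) K l n v :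
    k != 0 -> (`|k| <= K)%N ->
    (forall j u, X j (f u) = f (X j u) + (if `|j|%N == `|k|%N then u else 0)) ->
  pow_coef K l.+1 n (f v) = f (pow_coef K l.+1 n v) +
    l.+1%:R *: (pow_coef K l (n - k) v + pow_coef K l (n + k) v).
Proof.
move=> k0 kK fX; pose d j u : M := if `|j|%N == `|k|%N then u else 0.
have sum_d (g : int -> M) : \sum_(i <- window K) d i (g i) = g k + g (- k).
  rewrite (@sum_window2 _ _ k (- k)) /d ?abszN ?eqxx //; first by lia.
  by move=> i ik iNk; case: eqP => //; lia.
elim: l n => [|l IHl] n.
  have f0 i : pow_coef K 0 i (f v) = f (pow_coef K 0 i v).
    by rewrite /=; case: eqP; rewrite ?raddf0.
  rewrite !pow_coefS; under eq_bigr do rewrite f0 fX -/(d _ _).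
  by rewrite big_split -linear_sum sum_d opprK scale1r.
rewrite [LHS]pow_coefS [pow_coef _ _.+2 _ _]pow_coefS.
under eq_bigr do rewrite IHl linearD linearZ fX -/(d _ _).
rewrite !big_split -linear_sum /= sum_d -addrA opprK; congr (f _ + _).
rewrite [l.+2%:R]mulrS scalerDl scale1r; congr (_ + _).
rewrite -scaler_sumr; congr (_ *: _).
rewrite -big_split; apply: eq_bigr => i _ /=.
by rewrite raddfD [n - i - k]addrAC [n - i + k]addrAC.
Qed.

(** This makes the support of the sum in [exp_coef] finite: [L] bounds the powers that occur and [K]
    the indices. *)
Definition exp_bounded (L K : nat) n v := forall s, \sum_(i <- s) i = n ->
  foldr Xf v s != 0 -> (size s <= L)%N && all (mem (window K)) s.

Lemma exp_boundedW L K L' K' n v : (L <= L')%N -> (K <= K')%N ->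
  exp_bounded L K n v -> exp_bounded L' K' n v.
Proof.
move=> LL' KK' bdv s sn sv; have /andP[sL /allP sK] := bdv s sn sv.
rewrite (leq_trans sL) //; apply/allP => i /sK /=.
by rewrite !mem_window => /leq_trans; apply.
Qed.

Lemma exp_coefE L K n v : exp_bounded L K n v ->
  exp_coef Xf n v = \sum_(0 <= l < L.+1) (l`!%:R)^-1 *: pow_coef K l n v.
Proof.
move=> bdv; pose r := [seq s | l <- iota 0 L.+1, s <- box K l].
have r_uniq : uniq r.
  apply: allpairs_uniq_dep => [||[l s] [k t]].
  - exact: iota_uniq.
  - by move=> l _; apply: box_uniq.
  case/allpairsPdep=> l1 [s1 [_ + [-> ->]]] /allpairsPdep[k1 [t1 [_ + [-> ->]]]] /=.
  by rewrite !mem_box => /andP[/eqP<- _] /andP[/eqP<- _] ->.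
rewrite /exp_coef; transitivity
  (\sum_(s <- r | \sum_(i <- s) i == n) (size s)`!%:R^-1 *: foldr Xf v s).
  rewrite [RHS](bigfs _ r_uniq); last first.
    move=> s /eqP sn; apply: contraNeq; rewrite scaler_eq0 negb_or => /andP[_].
    move/(bdv _ sn) => /andP[sK sb]; apply/allpairsPdep; exists (size s), s.
    by rewrite mem_iota mem_box eqxx.
  by apply: eq_fsbigl; apply/seteqP; split => s /= /eqP.
rewrite big_mkcond big_allpairs_dep /index_iota subn0; apply: eq_bigr => l _.
rewrite pow_coefE scaler_sumr [RHS]big_mkcond big_seq [RHS]big_seq.
by apply: eq_bigr => s; rewrite mem_box => /andP[/eqP-> _].
Qed.

Definition exp_finite := forall n v, exists K, exp_bounded K K n v.

Lemma exp_coef_is_linear : exp_finite -> forall n, linear (exp_coef Xf n).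
Proof.
move=> Xfin n c u v.
have [K1 bd1] := Xfin n u; have [K2 bd2] := Xfin n v.
have [K3 bd3] := Xfin n (c *: u + v).
pose K := maxn K1 (maxn K2 K3).
rewrite !(@exp_coefE K K) ?scaler_sumr -?big_split /=; first last.
- by apply: exp_boundedW bd3; rewrite /K; lia.
- by apply: exp_boundedW bd1; rewrite /K; lia.
- by apply: exp_boundedW bd2; rewrite /K; lia.
apply: eq_bigr => l _.
by rewrite linearP scalerDr !scalerA mulrC.
Qed.

Lemma exp_coef_comm (f : {linear M -> M}) n v : exp_finite ->
  (forall i u, f (X i u) = X i (f u)) -> f (exp_coef Xf n v) = exp_coef Xf n (f v).
Proof.
move=> Xfin fX; have [K1 bd1] := Xfin n v; have [K2 bd2] := Xfin n (f v).
pose K := maxn K1 K2.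
rewrite !(@exp_coefE K K) ?linear_sum; first last.
- by apply: exp_boundedW bd1; rewrite /K; lia.
- by apply: exp_boundedW bd2; rewrite /K; lia.
by apply: eq_bigr => l _; rewrite linearZ pow_coef_comm.
Qed.

Lemma exp_coef_opp n v : (forall i u, X (- i) u = X i u) ->
  exp_coef Xf (- n) v = exp_coef Xf n v.
Proof.
move=> XN; rewrite /exp_coef (@reindex_fsbig _ _ _ _ _ (map -%R) [set s | \sum_(i <- s) i = n]).
  apply: eq_fsbigr => s _; rewrite size_map; congr (_ *: _).
  by elim: s => //= i s ->; rewrite XN.
have sumN s : \sum_(i <- map -%R s) i = - \sum_(i <- s) i.
  by rewrite big_map sumrN.
split=> [s /= <-|s t _ _|s /= sn]; first exact: sumN.
  by apply: inj_map; apply: oppr_inj.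
exists (map -%R s); last by rewrite mapK //; apply: opprK.
by rewrite /= sumN sn opprK.
Qed.

Hypothesis F0 : [pchar F] =i pred0.

Let natf_neq0 (n : nat) : n.+1%:R != 0 :> F.
Proof. by rewrite ((pcharf0P F).1 F0). Qed.

Let invfact l : (l.+1`!%:R)^-1 * l.+1%:R = (l`!%:R)^-1 :> F.
Proof. by rewrite factS natrM invfM mulrAC mulVf ?mul1r. Qed.

(** z d/dz exp X(z) = (z X'(z)) exp X(z), obtained power by power. The last bound is asked only
    where [X i] is nonzero: for the creation exponent this means [i > 0], so that [n - i] is below
    [n]. *)
Lemma exp_coef_euler L K n v : (forall i j u, X i (X j u) = X j (X i u)) ->
    exp_bounded L.+1 K n v ->
    (forall i, (exists u, X i u != 0) -> exp_bounded L K (n - i) v) ->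
  n%:~R *: exp_coef Xf n v = \sum_(i <- window K) i%:~R *: X i (exp_coef Xf (n - i) v).
Proof.
move=> XC bdv bdX; rewrite (exp_coefE bdv) scaler_sumr big_nat_recl //=.
rewrite (_ : _ *: (_ *: _) = 0) ?add0r; last first.
  by case: eqP => [->|]; rewrite ?scale0r ?scaler0.
under eq_bigr do rewrite scalerA mulrC -scalerA pow_coef_euler // scalerA invfact scaler_sumr.
rewrite exchange_big; apply: eq_bigr => i _ /=.
have [Xi|Xi0] := pselect (exists u, X i u != 0); last first.
  have {}Xi0 u : X i u = 0 by apply: contra_notP Xi0 => /eqP; exists u.
  by rewrite big1 => [|l _]; rewrite Xi0 ?scaler0.
rewrite (exp_coefE (bdX i Xi)) linear_sum scaler_sumr; apply: eq_bigr => l _.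
by rewrite [X i _ in RHS]linearZ /= !scalerA mulrC.
Qed.

(** Since z^k + z^(-k) is central, commuting exp X(z) with [f] multiplies the exponential by it. *)
Lemma exp_coef_shift (f : {linear M -> M}) (k : int) n v :
    exp_finite -> k != 0 ->
    (forall j u, X j (f u) = f (X j u) + (if `|j|%N == `|k|%N then u else 0)) ->
  exp_coef Xf n (f v) =
    f (exp_coef Xf n v) + (exp_coef Xf (n - k) v + exp_coef Xf (n + k) v).
Proof.
move=> Xfin k0 fX.
have [K1 bd1] := Xfin n v; have [K2 bd2] := Xfin n (f v).
have [K3 bd3] := Xfin (n - k) v; have [K4 bd4] := Xfin (n + k) v.
pose K := maxn (maxn K1 K2) (maxn (maxn K3 K4) `|k|).
(* One more power is kept on these terms because the commutator lowers the power by one. *)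
rewrite (@exp_coefE K.+1 K n v) ?(@exp_coefE K.+1 K n (f v)); first last.
- by apply: exp_boundedW bd1; rewrite /K; lia.
- by apply: exp_boundedW bd2; rewrite /K; lia.
rewrite (@exp_coefE K K (n - k) v) ?(@exp_coefE K K (n + k) v); first last.
- by apply: exp_boundedW bd3; rewrite /K; lia.
- by apply: exp_boundedW bd4; rewrite /K; lia.
rewrite big_nat_recl // [in RHS]big_nat_recl // [f (_ + _)]linearD -!addrA; congr (_ + _).
  by rewrite linearZ /=; case: eqP; rewrite ?linear0.
rewrite linear_sum -!big_split /=; apply: eq_bigr => l _.
rewrite -!pow_coefS (pow_coef_shift _ _ _ k0) //; last by rewrite /K; lia.
by rewrite [RHS]addrC [in RHS]linearZ /= -scalerDr [LHS]scalerDr scalerA invfact addrC.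
Qed.

End ExpCoef.

(** * Vertex operators on the Fock space *)

Section Vertex.
Variables (F : fieldType) (M : lmodType F) (a : int -> {linear M -> M}) (vac : M).
Hypotheses (F0 : [pchar F] =i pred0) (fockM : fock_space a vac).
Implicit Types (u v : M) (n i j k p q : int) (d K : nat) (s : seq nat).

Lemma intf_eq0 k : (k%:~R == 0 :> F) = (k == 0).
Proof. by case: k => n; rewrite ?NegzE ?rmorphN ?oppr_eq0 /= ((pcharf0P F).1 F0). Qed.

Lemma annihilators_comm i j v : 0 < i -> 0 < j -> a i (a j v) = a j (a i v).
Proof.
move=> i0 j0; apply/subr0_eq; rewrite (heisenberg_comm fockM); try lia.
by rewrite (_ : (i == - j) = false) ?scale0r //; lia.
Qed.

Lemma creators_comm i j v : 0 < i -> 0 < j -> a (- i) (a (- j) v) = a (- j) (a (- i) v).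
Proof.
move=> i0 j0; apply/subr0_eq; rewrite (heisenberg_comm fockM); try lia.
by rewrite (_ : (- i == - - j) = false) ?scale0r //; lia.
Qed.

Lemma annihilator_creator i j v : 0 < i -> 0 < j ->
  a i (a (- j) v) = a (- j) (a i v) + (if i == j then i%:~R *: v else 0).
Proof.
move=> i0 j0; apply/eqP; rewrite addrC -subr_eq; apply/eqP.
rewrite (heisenberg_comm fockM) ?opprK; try lia.
by case: ifP; rewrite ?scale0r.
Qed.

(** * Degree bounds on the Fock space and finiteness of both exponentials *)

Definition annihilate s v := foldr (fun (p : nat) u => a p%:Z u) v s.

Lemma annihilate_cons (p : nat) s v : annihilate (p :: s) v = a p (annihilate s v).
Proof. by []. Qed.

Lemma annihilate_is_linear s : linear (annihilate s).
Proof. by elim: s => [|p s IHs] c u v //; rewrite !annihilate_cons IHs linearP. Qed.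

HB.instance Definition _ s :=
  GRing.isLinear.Build F M M *:%R (annihilate s) (annihilate_is_linear s).

Lemma annihilate_rcons s (p : nat) v : annihilate (rcons s p) v = annihilate s (a p v).
Proof. exact: foldr_rcons. Qed.

(** Degree is tested by annihilators rather than read off a monomial expansion, so it passes
    directly through commutation relations. *)
Definition deg_le d v := forall s, 0%N \notin s -> (d < sumn s)%N -> annihilate s v = 0.

Lemma deg_leW d e v : (d <= e)%N -> deg_le d v -> deg_le e v.
Proof. by move=> de dv s s0 es; apply: dv => //; apply: leq_ltn_trans es. Qed.

Lemma deg_le0 d : deg_le d 0.
Proof. by move=> s _ _; rewrite linear0. Qed.

Lemma deg_leP d c u v : deg_le d u -> deg_le d v -> deg_le d (c *: u + v).
Proof. by move=> du dv s s0 ds; rewrite linearP /= du // dv // scaler0 addr0. Qed.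

Lemma deg_le_vac : deg_le 0 vac.
Proof.
elim=> [|p s IHs] //; rewrite inE negb_or annihilate_cons => /andP[p0 s0] _.
case: s => [|q s] in IHs s0 *; first by rewrite /= (vac_annihilated fockM) //; lia.
rewrite IHs ?linear0 //=; move: s0; rewrite inE negb_or; lia.
Qed.

Lemma deg_le_annihilator d (p : nat) v : (0 < p)%N -> deg_le d v -> deg_le (d - p) (a p v).
Proof.
move=> p0 dv s s0 ds; rewrite -annihilate_rcons.
by apply: dv; rewrite ?mem_rcons ?inE ?negb_or ?s0 ?sumn_rcons; lia.
Qed.

(** The innermost annihilator is commuted past the creator: one term has [a q v], of degree lower by
    [q], and the commutator is a multiple of [v]. *)
Lemma deg_le_creator d (p : nat) v : (0 < p)%N -> deg_le d v -> deg_le (d + p) (a (- p%:Z) v).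
Proof.
move=> p0 + s; elim/last_ind: s v d => [|s q IHs] v d dv; first by rewrite ltn0.
rewrite mem_rcons inE negb_or sumn_rcons => /andP[q0 s0] ds.
rewrite annihilate_rcons annihilator_creator ?linearD /=; try lia.
have -> : annihilate s (a (- p%:Z) (a q v)) = 0.
  (* For [q > d] the truncated [d - q] loses information, but then [a q v] already vanishes. *)
  have [qd|dq] := leqP q d.
    by apply: IHs (deg_le_annihilator _ dv) _ _ => //; lia.
  rewrite (_ : a q v = 0) ?linear0 //; apply: (dv [:: q]); rewrite /= ?inE ?orbF ?addn0 //.
by rewrite add0r; case: eqP => qp; rewrite ?linear0 // linearZ /= dv ?scaler0 //; lia.
Qed.

Lemma deg_le_ex v : exists d, deg_le d v.
Proof.
have [S [c [Spos ->]]] := monomials_span fockM v.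
elim: S Spos => [|s S IHS] /=; first by exists 0%N; rewrite big_nil; apply: deg_le0.
case/andP=> /andP[_ s0] /IHS[d dS]; exists (maxn (sumn s) d); rewrite big_cons.
apply: deg_leP; last by apply: deg_leW dS; apply: leq_maxr.
apply: deg_leW (leq_maxl _ _) _; elim: s s0 => [|p s IHs] /=; first by move=> _; apply: deg_le_vac.
rewrite inE negb_or => /andP[p0 /IHs ds].
by rewrite addnC; apply: deg_le_creator => //; lia.
Qed.

Lemma annihilation_exponent_is_linear i : linear (annihilation_exponent a i).
Proof.
move=> c u v; rewrite /annihilation_exponent; case: ifP; rewrite ?scaler0 ?addr0 //.
by rewrite [a _ _]linearP /= scalerDr !scalerA mulrC.
Qed.

HB.instance Definition _ i := GRing.isLinear.Build F M M *:%R
  (annihilation_exponent a i) (annihilation_exponent_is_linear i).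

Lemma creation_exponent_is_linear i : linear (creation_exponent a i).
Proof.
move=> c u v; rewrite /creation_exponent; case: ifP; rewrite ?scaler0 ?addr0 //.
by rewrite [a _ _]linearP /= scalerDr !scalerA opprD scalerN scalerA mulrC.
Qed.

HB.instance Definition _ i := GRing.isLinear.Build F M M *:%R
  (creation_exponent a i) (creation_exponent_is_linear i).

Let X i : {linear M -> M} := annihilation_exponent a i.
Let Y i : {linear M -> M} := creation_exponent a i.

(** Up to a scalar, a word of annihilation exponents is the product of the annihilators with the
    absolute indices. *)
Lemma deg_le_annihilation_exponent d v (s : seq int) : deg_le d v ->
  foldr (fun i => X i) v s != 0 -> (0 \notin s) && (sumn (map absz s) <= d)%N.
Proof.
move=> dv sv; have s0 : 0 \notin s.
  apply: contraNN sv; elim: s => //= i s IHs; rewrite inE => /orP[/eqP<-|/IHs/eqP->].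
    by rewrite /annihilation_exponent eqxx.
  by rewrite linear0.
rewrite s0 leqNgt; apply: contraNN sv => ds.
suff [c ->] : exists c, foldr (fun i => X i) v s = c *: annihilate (map absz s) v.
  rewrite dv ?scaler0 //; apply: contraNN s0 => /mapP[i i_s].
  by move/esym/eqP; rewrite absz_eq0 => /eqP <-.
elim: s {ds} s0 => [|i s IHs] /=; first by exists 1; rewrite scale1r.
rewrite inE negb_or => /andP[i0 /IHs[c ->]].
rewrite linearZ /= /annihilation_exponent eq_sym (negbTE i0).
by exists (c * `|i|%:~R^-1); rewrite scalerA.
Qed.

Lemma annihilation_bounded d n v : deg_le d v -> exp_bounded X d d n v.
Proof.
move=> dv s _ /(deg_le_annihilation_exponent dv)/andP[s0 sd]; apply/andP; split.
  apply: leq_trans sd; elim: s s0 => //= i s IHs; rewrite inE negb_or => /andP[i0 /IHs].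
  by move: i0; lia.
apply/allP => i i_s /=; rewrite mem_window; apply: leq_trans sd.
elim: s {s0} i_s => //= j s IHs; rewrite inE => /orP[/eqP->|/IHs]; lia.
Qed.

Lemma annihilation_finite : exp_finite X.
Proof. by move=> n v; have [d dv] := deg_le_ex v; exists d; apply: annihilation_bounded. Qed.

Lemma creation_exponent_pos v (s : seq int) :
  foldr (fun i => Y i) v s != 0 -> all (fun i => 0 < i) s.
Proof.
elim: s => //= i s IHs; rewrite /creation_exponent; case: ifP; rewrite ?eqxx //.
by move=> _ sv; apply: IHs; apply: contraNN sv => /eqP->; rewrite linear0 scaler0 oppr0.
Qed.

Lemma absz_sum_le (s : seq int) : (absz (\sum_(i <- s) i)%R <= sumn (map absz s))%N.
Proof.
elim: s => [|i s]; rewrite ?big_nil // big_cons /=; set S := \sum_(_ <- _) _; lia.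
Qed.

Lemma size_le_sum_pos (s : seq int) : all (fun i => 0 < i) s -> (size s)%:Z <= \sum_(i <- s) i.
Proof.
by elim: s => [|i s IHs]; rewrite ?big_nil // big_cons => /andP[i0 /IHs]; rewrite /=; lia.
Qed.

Lemma mem_le_sum_pos (s : seq int) i : all (fun i => 0 < i) s -> i \in s ->
  0 < i <= \sum_(i <- s) i.
Proof.
elim: s => // j s IHs /andP[j0 s0]; rewrite big_cons inE.
have := size_le_sum_pos s0; set S := \sum_(_ <- _) _ in IHs * => sS.
by case/orP => [/eqP->|/(IHs s0)]; lia.
Qed.

(** In a nonzero creation word all indices are positive and add up to [n]; the bound does not depend
    on [v]. *)
Lemma creation_bounded L K n v : n <= L%:Z -> n <= K%:Z -> exp_bounded Y L K n v.
Proof.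
move=> nL nK s sn /creation_exponent_pos s0; rewrite -sn in nL nK; apply/andP; split.
  by have := size_le_sum_pos s0; lia.
apply/allP => i /(mem_le_sum_pos s0)/andP[i0 iS] /=; rewrite mem_window.
have := le_trans iS nK; lia.
Qed.

Lemma creation_finite : exp_finite Y.
Proof. by move=> n v; exists `|n|%N; apply: creation_bounded; lia. Qed.

(** * Coefficients of A(z) and B(z), and their commutation relations *)

Definition creation_coef n v := exp_coef (creation_exponent a) n v.
Definition annihilation_coef n v := exp_coef (annihilation_exponent a) n v.
Local Notation A := creation_coef.
Local Notation B := annihilation_coef.

Lemma creation_coef_is_linear n : linear (A n).
Proof. exact: exp_coef_is_linear creation_finite n. Qed.

Lemma annihilation_coef_is_linear n : linear (B n).
Proof. exact: exp_coef_is_linear annihilation_finite n. Qed.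

HB.instance Definition _ n := GRing.isLinear.Build F M M *:%R (A n) (creation_coef_is_linear n).
HB.instance Definition _ n := GRing.isLinear.Build F M M *:%R (B n) (annihilation_coef_is_linear n).

Lemma creation_coef_neg n v : n < 0 -> A n v = 0.
Proof.
move=> n0; apply: fsbig1 => s /= sn; have [->|] := eqVneq (foldr (creation_exponent a) v s) 0.
  by rewrite scaler0.
by move/creation_exponent_pos/size_le_sum_pos; rewrite sn; lia.
Qed.

Lemma creation_coef_0 v : A 0 v = v.
Proof.
rewrite /A (@exp_coefE _ _ Y 0 0); last exact: creation_bounded.
by rewrite big_nat1 invr1 scale1r.
Qed.

Lemma annihilation_coef_deg d n v : deg_le d v -> (d < `|n|)%N -> B n v = 0.
Proof.
move=> dv dn; apply: fsbig1 => s /= sn.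
have [->|] := eqVneq (foldr (annihilation_exponent a) v s) 0.
  by rewrite scaler0.
move/(deg_le_annihilation_exponent dv)/andP=> [_ sd].
by have := absz_sum_le s; rewrite sn; lia.
Qed.

Lemma annihilation_coef_vac n : B n vac = if n == 0 then vac else 0.
Proof.
rewrite /B (@exp_coefE _ _ X 0 0); last exact: annihilation_bounded deg_le_vac.
by rewrite big_nat1 invr1 scale1r.
Qed.

(** The annihilation exponent is invariant under z -> 1/z; the reflection of the bra comes from this
    symmetry. *)
Lemma annihilation_coef_opp n v : B (- n) v = B n v.
Proof.
apply: (@exp_coef_opp _ _ X) => i u.
by rewrite /= /annihilation_exponent oppr_eq0 normrN.
Qed.

Lemma creation_exponent_comm i j u : Y i (Y j u) = Y j (Y i u).
Proof.
rewrite /= /creation_exponent; do 2!case: ifP => ?; rewrite ?linear0 ?scaler0 ?oppr0 //.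
by rewrite !linearN !linearZ /= creators_comm // !scalerA mulrC.
Qed.

Lemma creation_coef_comm n p v : A n (A p v) = A p (A n v).
Proof.
apply: (@exp_coef_comm _ _ Y (A n)) => [|i u]; first exact: creation_finite.
symmetry; apply: (@exp_coef_comm _ _ Y); first exact: creation_finite.
by move=> *; apply: creation_exponent_comm.
Qed.

Lemma annihilation_exponent_comm i j u : X i (X j u) = X j (X i u).
Proof.
rewrite /= /annihilation_exponent.
case: eqP => i0; case: eqP => j0; rewrite ?linear0 ?scaler0 //.
by rewrite !linearZ /= annihilators_comm ?normr_gt0 ?scalerA 1?mulrC; try lia.
Qed.

Lemma annihilation_coef_comm n p v : B n (B p v) = B p (B n v).
Proof.
apply: (@exp_coef_comm _ _ X (B n)) => [|i u]; first exact: annihilation_finite.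
symmetry; apply: (@exp_coef_comm _ _ X); first exact: annihilation_finite.
by move=> *; apply: annihilation_exponent_comm.
Qed.

Lemma annihilation_coef_annihilator n (p : nat) v : (0 < p)%N -> a p (B n v) = B n (a p v).
Proof.
move=> p0; apply: (@exp_coef_comm _ _ X (a p)); first exact: annihilation_finite.
move=> i u; rewrite /= /annihilation_exponent; case: eqP => i0; rewrite ?linear0 //.
by rewrite linearZ /= annihilators_comm //; lia.
Qed.

Lemma deg_le_annihilation_coef d n v : deg_le d v -> deg_le d (B n v).
Proof.
move=> dv s s0 ds; suff -> : annihilate s (B n v) = B n (annihilate s v).
  by rewrite dv // linear0.
elim: s s0 {ds} => // p s IHs; rewrite inE negb_or => /andP[p0 s0].
by rewrite !annihilate_cons IHs // annihilation_coef_annihilator //; lia.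
Qed.

(** The factor 1/|j| of the exponent cancels the scalar of the Heisenberg commutator, leaving z^p +
    z^(-p). *)
Lemma annihilation_coef_creator n (p : nat) v : (0 < p)%N ->
  B n (a (- p%:Z) v) = a (- p%:Z) (B n v) + (B (n - p%:Z) v + B (n + p%:Z) v).
Proof.
move=> p0; apply: (@exp_coef_shift _ _ X F0 (a (- p%:Z))).
- exact: annihilation_finite.
- lia.
move=> j u; rewrite /= /annihilation_exponent; case: eqP => [->|j0].
  by rewrite linear0 (_ : _ == _ = false) ?addr0 //; lia.
rewrite annihilator_creator; try lia.
rewrite scalerDr linearZ; congr (_ + _) => /=.
rewrite (_ : (`|j| == p%:Z) = (`|j|%N == `|p%:Z|%N)); last by lia.
case: ifP => _; rewrite ?scaler0 // scalerA mulVf ?scale1r // intf_eq0; lia.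
Qed.

(** z A'(z) = - (sum of a_(-k) z^k) A(z). Any cutoff [N >= n] serves, since coefficients of negative
    index vanish. *)
Lemma creation_coef_euler (N : nat) n v : n <= N%:Z ->
  n%:~R *: A n v = - \sum_(1 <= k < N.+1) a (- k%:Z) (A (n - k%:Z) v).
Proof.
move=> nN; have [n0|n0] := leP n 0.
  rewrite big_nat_cond big1 => [|k /andP[/andP[k1 _] _]]; last first.
    by rewrite creation_coef_neg ?linear0 //; lia.
  have [->|n_neq0] := eqVneq n 0; first by rewrite scale0r oppr0.
  by rewrite creation_coef_neg ?scaler0 ?oppr0 //; lia.
rewrite /A (@exp_coef_euler _ _ Y F0 `|n|.-1 N) //; first last.
- move=> i [u]; rewrite /= /creation_exponent; case: ifP => i0; last by rewrite eqxx.
  by move=> _; apply: creation_bounded; lia.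
- by apply: creation_bounded; lia.
- exact: creation_exponent_comm.
rewrite big_map -[iota _ _]/(index_iota 0 (2 * N).+1) (big_cat_nat (n := N.+1)) //=; last by lia.
rewrite big_nat_cond big1 ?add0r => [|k /andP[/andP[_ kN] _]]; last first.
  by rewrite /creation_exponent ifF ?scaler0 //; lia.
rewrite -[X in index_iota X]add1n big_addn -sumrN (_ : ((2 * N).+1 - N = N.+1)%N); last by lia.
rewrite [LHS]big_nat_cond [RHS]big_nat_cond; apply: eq_bigr => k /andP[/andP[k0 _] _].
rewrite PoszD addrK /creation_exponent ifT; last by lia.
by rewrite scalerN scalerA mulfV ?scale1r // intf_eq0; lia.
Qed.

(* B(z) A(w) = (1 - w (z + 1/z) + w^2) A(w) B(z). *)
Lemma annihilation_creation_coef i p v :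
  B i (A p v) = A p (B i v) - A (p - 1) (B (i + 1) v + B (i - 1) v) + A (p - 2) (B i v).
Proof.
pose R j q := A q (B j v) - A (q - 1) (B (j + 1) v + B (j - 1) v) + A (q - 2) (B j v).
rewrite -/(R i p); have [p0|p0] := leP p 0.
  rewrite /R !(@creation_coef_neg (p - 1)) ?(@creation_coef_neg (p - 2)) ?subr0 ?addr0; try lia.
  have [->|pn0] := eqVneq p 0; first by rewrite !creation_coef_0.
  by rewrite !creation_coef_neg ?linear0 //; lia.
have [n ->] : exists n : nat, p = n%:Z by exists `|p|%N; lia.
elim/ltn_ind: n i {p p0} => N IHN i; have [->|N_gt0] := posnP N.
  by rewrite /R !creation_coef_0 !(@creation_coef_neg (0 - _)) // subr0 addr0.
pose S (k : nat) := B (i + k%:Z) v + B (i - k%:Z) v.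
(* By induction the commutator terms for [k] add up to A_(N-k) S_k - A_(N-k-1) (S_(k+1) + S_(k-1)) +
   A_(N-k-2) S_k, which is [G k - G k.+1]. *)
pose G (k : nat) := A (N%:Z - k%:Z) (S k) - A (N%:Z - k%:Z - 1) (S k.-1).
have N0 : N%:~R != 0 :> F by rewrite intf_eq0; lia.
apply: (scalerI N0); rewrite -linearZ /= (@creation_coef_euler N) //.
rewrite [B _ _]linearN /= [B _ _]linear_sum /=.
transitivity (- \sum_(1 <= k < N.+1) a (- k%:Z) (R i (N%:Z - k%:Z))
   - \sum_(1 <= k < N.+1) (G k - G k.+1)).
  rewrite -opprD -big_split; apply: (congr1 -%R).
  rewrite [LHS]big_nat_cond [RHS]big_nat_cond.
  apply: eq_bigr => k /andP[/andP[k1 kN] _] /=.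
  have IH j : B j (A (N%:Z - k%:Z) v) = R j (N%:Z - k%:Z).
    by rewrite subzn ?IHN //; lia.
  rewrite annihilation_coef_creator // !IH; congr (_ + _); rewrite /R /G /S.
  have -> : i - k.-1%:Z = i - k%:Z + 1 by lia.
  have -> : i + k.-1%:Z = i + k%:Z - 1 by lia.
  have -> : i - k.+1%:Z = i - k%:Z - 1 by lia.
  have -> : i + k.+1%:Z = i + k%:Z + 1 by lia.
  have -> : N%:Z - k.+1%:Z = N%:Z - k%:Z - 1 by lia.
  have -> : N%:Z - k%:Z - 1 - 1 = N%:Z - k%:Z - 2 by lia.
  rewrite !linearD /= !opprD !opprK.
  by rewrite (AC (1 * 2 * 1 * (1 * 2 * 1)) (5 * 1 * (7 * 2) * ((6 * 3) * (8 * 4)))).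
under [X in _ - X]eq_bigr do rewrite -opprB.
rewrite sumrN opprK telescope_sumr ?ltnS //.
have -> : G N.+1 = 0 by rewrite /G !creation_coef_neg ?subr0 //; lia.
rewrite {1}/R !scalerDr scalerN.
(* Euler's relation for A_(N-1) and A_(N-2) carries the weights N - 1 and N - 2; the remainders 1
   and 2 are matched by [G 1], where [S 0] is twice [B i v]. *)
have NE (m : nat) (w : M) : N%:~R *: w = (N%:Z - m%:Z)%:~R *: w + w *+ m.
  by rewrite -scaler_nat -scalerDl pmulrn -intrD subrK.
rewrite (NE 1%N (A _ (_ + _))) (NE 2%N (A (_ - 2) _)) !(@creation_coef_euler N) //; try lia.
have -> : \sum_(1 <= k < N.+1) a (- k%:Z) (R i (N%:Z - k%:Z)) =
    \sum_(1 <= k < N.+1) a (- k%:Z) (A (N%:Z - k%:Z) (B i v)) -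
    \sum_(1 <= k < N.+1) a (- k%:Z) (A (N%:Z - 1 - k%:Z) (B (i + 1) v + B (i - 1) v)) +
    \sum_(1 <= k < N.+1) a (- k%:Z) (A (N%:Z - 2 - k%:Z) (B i v)).
  rewrite -sumrB -big_split; apply: eq_bigr => k _ /=.
  rewrite [N%:Z - 1 - _]addrAC [N%:Z - 2 - _]addrAC.
  by rewrite /R [a _ (_ + _)]linearD [a _ (_ - _)]linearB.
have -> : G 1%N = A (N%:Z - 1) (B (i + 1) v + B (i - 1) v) - A (N%:Z - 2) (B i v) *+ 2.
  rewrite /G (_ : N%:Z - 1%:Z - 1 = N%:Z - 2); last by lia.
  by rewrite /S /= !addr0 -mulr2n linearMn.
rewrite sub0r mulr1n !opprD !opprK !addrA.
by rewrite (AC 6 (1 * 2 * 4 * 3 * 5 * 6)).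
Qed.

Lemma Estar_window d K n v : deg_le d v -> (d <= K)%N ->
  Estar a n v = \sum_(i <- window K) A (n - i) (B i v).
Proof.
move=> dv dK; apply: fsum_window => i Ki.
by rewrite -/(A _ _) -/(B _ _) (annihilation_coef_deg dv) ?linear0 // (leq_ltn_trans dK).
Qed.

Lemma Estar_is_linear n : linear (Estar a n).
Proof.
move=> c u v; have [d du] := deg_le_ex u; have [e ev] := deg_le_ex v.
pose K := maxn d e; have uK : deg_le K u by apply: deg_leW du; apply: leq_maxl.
have vK : deg_le K v by apply: deg_leW ev; apply: leq_maxr.
rewrite (Estar_window _ uK (leqnn K)) (Estar_window _ vK (leqnn K)).
rewrite (Estar_window _ (deg_leP c uK vK) (leqnn K)).
by rewrite scaler_sumr -big_split; apply: eq_bigr => i _; rewrite !linearP.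
Qed.

HB.instance Definition _ n := GRing.isLinear.Build F M M *:%R (Estar a n) (Estar_is_linear n).

Lemma Estar_vac n : Estar a n vac = A n vac.
Proof.
rewrite (Estar_window _ deg_le_vac (leqnn 0)) (@sum_window1 _ _ 0) ?annihilation_coef_vac ?subr0 //.
by move=> i i0; rewrite annihilation_coef_vac (negbTE i0) linear0.
Qed.

(** The coefficient of z^p w^q in A(z) A(w) B(z) B(w), truncated to a window. *)
Definition normal_product K p q v :=
  \sum_(i <- window K) \sum_(j <- window K) A (p - i) (A (q - j) (B i (B j v))).

Lemma normal_productC K p q v : normal_product K p q v = normal_product K q p v.
Proof.
rewrite /normal_product exchange_big; apply: eq_bigr => i _; apply: eq_bigr => j _ /=.
by rewrite creation_coef_comm annihilation_coef_comm.
Qed.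

(** E*(z) E*(w) is the normally ordered product times 1 - w (z + 1/z) + w^2. Validity for all large
    [K] lets two such expansions share a window. *)
Lemma Estar_comp p q v : exists K0, forall K, (K0 <= K)%N ->
  Estar a p (Estar a q v) = normal_product K p q v - normal_product K (p + 1) (q - 1) v
    - normal_product K (p - 1) (q - 1) v + normal_product K p (q - 2) v.
Proof.
have [d dv] := deg_le_ex v; have [e ev] := deg_le_ex (Estar a q v).
exists (maxn e d.+1) => K; rewrite geq_max => /andP[eK dK].
rewrite (Estar_window _ ev eK) (Estar_window _ dv (ltnW dK)) /normal_product.
(* The shift of the index of [B] is absorbed into the outer sum. As [K] exceeds the degree of [v]
   and [h] moves indices by at most one, nothing is lost at the boundary. *)
have shift (r s t : int) (h : int -> int) : (forall i, `|h i - i| <= 1)%N -> bijective h ->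
    (forall i, r - i = t - h i) ->
  \sum_(i <- window K) \sum_(j <- window K) A (r - i) (A (s - j) (B (h i) (B j v))) =
  \sum_(i <- window K) \sum_(j <- window K) A (t - i) (A (s - j) (B i (B j v))).
  move=> h1 h_bij rt.
  rewrite -(@reindex_window _ h K K
    (fun i => \sum_(j <- window K) A (t - i) (A (s - j) (B i (B j v))))) //.
  - by apply: eq_bigr => i _; apply: eq_bigr => j _; rewrite rt.
  - move=> i iK; apply: big1 => j _.
    rewrite (annihilation_coef_deg (deg_le_annihilation_coef _ dv)) ?linear0 //.
    by have := h1 i; lia.
  - move=> i iK; apply: big1 => j _.
    rewrite (annihilation_coef_deg (deg_le_annihilation_coef _ dv)) ?linear0 //; lia.
have bij_add k : bijective (fun i : int => i + k).
  by exists (fun i => i - k) => i; rewrite ?addrK ?subrK.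
rewrite -(shift p (q - 1) (p + 1) (fun i => i + 1)); first last.
- by move=> i /=; lia.
- exact: bij_add.
- by move=> i /=; lia.
rewrite -(shift p (q - 1) (p - 1) (fun i => i - 1)); first last.
- by move=> i /=; lia.
- exact: bij_add.
- by move=> i /=; lia.
have linear4 (f : {linear M -> M}) x y1 y2 z :
  f (x - (y1 + y2) + z) = f x - (f y1 + f y2) + f z by rewrite linearD linearB linearD.
rewrite -!sumrB -big_split; apply: eq_bigr => i _ /=.
rewrite [B i _]linear_sum [A _ _]linear_sum -!sumrB -big_split.
apply: eq_bigr => j _ /=; rewrite annihilation_creation_coef [q - 1 - j]addrAC [q - 2 - j]addrAC.
by rewrite [A _ (B _ _ + B _ _)]linearD linear4 opprD addrA.
Qed.

(** Swapping z and w multiplies the prefactor (1 - wz)(1 - w/z) by -z/w and preserves the normally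
    ordered product. *)
Lemma Estar_anticomm p q v : Estar a p (Estar a q v) = - Estar a (q - 1) (Estar a (p + 1) v).
Proof.
have [K1 E1] := Estar_comp p q v; have [K2] := Estar_comp (q - 1) (p + 1) v.
have -> : q - 1 + 1 = q by lia.
have -> : q - 1 - 1 = q - 2 by lia.
have -> : p + 1 - 1 = p by lia.
have -> : p + 1 - 2 = p - 1 by lia.
move=> E2.
rewrite (E1 (maxn K1 K2)) ?leq_maxl // (E2 (maxn K1 K2)) ?leq_maxr //.
rewrite (@normal_productC _ q) !(@normal_productC _ (q - 1)) (@normal_productC _ (q - 2)).
by rewrite !opprD !opprK !addrA (AC 4 (2 * 1 * 4 * 3)).
Qed.

(** * Action on the dual vacuum and the three families of operators *)

Variable phi : {linear M -> F^o}.
Hypothesis dual_phi : dual_vacuum a vac phi.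

(** For [n > 0], Euler's relation writes n A_n as a sum of vectors in the images of creators, which
    [phi] kills. *)
Lemma dual_creation_coef n v : phi (A n v) = if n == 0 then phi v else 0.
Proof.
case: eqP => [->|/eqP n0]; first by rewrite creation_coef_0.
have [nneg|npos] := ltP n 0; first by rewrite creation_coef_neg // linear0.
have n0F : n%:~R != 0 :> F by rewrite intf_eq0.
apply: (scalerI n0F); rewrite -linearZ /= (@creation_coef_euler `|n|) ?linearN ?scaler0; try lia.
rewrite linear_sum big_nat_cond big1 ?oppr0 // => k /andP[/andP[k1 _] _].
by rewrite dual_phi.2.
Qed.

Lemma dual_Estar n v : phi (Estar a n v) = phi (B n v).
Proof.
have [d dv] := deg_le_ex v.
rewrite (Estar_window _ dv (leq_maxl d `|n|)) linear_sum (@sum_window1 _ _ n).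
- by rewrite dual_creation_coef subrr eqxx.
- exact: leq_maxr.
- by move=> i iN; rewrite dual_creation_coef subr_eq0 eq_sym (negbTE iN).
Qed.

Lemma dual_Estar_opp n v : phi (Estar a (- n) v) = phi (Estar a n v).
Proof. by rewrite !dual_Estar annihilation_coef_opp. Qed.

(* U* is the case c = 1 and Y* the case c = 2. *)
Definition Ediff (c : nat) n v := Estar a n v - Estar a (n - c%:Z) v.

Lemma Ediff_is_linear c n : linear (Ediff c n).
Proof.
move=> k u v; rewrite /Ediff [Estar a n _]linearP [Estar a (n - _) _]linearP /=.
by rewrite scalerBr opprD addrACA.
Qed.

HB.instance Definition _ c n :=
  GRing.isLinear.Build F M M *:%R (Ediff c n) (Ediff_is_linear c n).

(** The scalar factor (1 - z^c)(1 - w^c) is symmetric, so the exchange relation of E* survives. *)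
Lemma Ediff_anticomm c p q v : Ediff c p (Ediff c q v) = - Ediff c (q - 1) (Ediff c (p + 1) v).
Proof.
have sh i : i - 1 - c%:Z = i - c%:Z - 1 by rewrite addrAC.
have sh' i : i + 1 - c%:Z = i - c%:Z + 1 by rewrite addrAC.
rewrite /Ediff !(linearB (Estar a _)) /= !(Estar_anticomm p) !(Estar_anticomm (p - _)).
rewrite sh sh' !opprB !opprK !addrA.
by rewrite (AC 4 (2 * 3 * 4 * 1)).
Qed.

Lemma Estar_neg_vac n : n < 0 -> Estar a n vac = 0.
Proof. by move=> n0; rewrite Estar_vac creation_coef_neg. Qed.

Lemma Estar_0_vac : Estar a 0 vac = vac.
Proof. by rewrite Estar_vac creation_coef_0. Qed.

Lemma Ediff_neg_vac c n : n < 0 -> Ediff c n vac = 0.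
Proof. by move=> n0; rewrite /Ediff !Estar_neg_vac ?subr0 //; lia. Qed.

Lemma Ediff_0_vac c : (0 < c)%N -> Ediff c 0 vac = vac.
Proof. by move=> c0; rewrite /Ediff Estar_0_vac Estar_neg_vac ?subr0 //; lia. Qed.

(** The numbers [phi (Estar a k v)] are even in [k], and 1 - z^c = - z^c (1 - z^(-c)): hence the
    sign and the reflection to [c - n]. *)
Lemma dual_Ediff_flip c n v : phi (Ediff c n v) = -1 * phi (Ediff c (c%:Z - n) v).
Proof.
have evenP (g : int -> F) : (forall k, g (- k) = g k) ->
    g n - g (n - c%:Z) = -1 * (g (c%:Z - n) - g (c%:Z - n - c%:Z)).
  move=> gN; have -> : c%:Z - n - c%:Z = - n by lia.
  have -> : c%:Z - n = - (n - c%:Z) by lia.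
  by rewrite !gN; ring.
rewrite /Ediff !(linearB phi); apply: (evenP (fun k => phi (Estar a k v))) => k.
exact: dual_Estar_opp.
Qed.

Lemma Ediff_frobenius c m la : (0 < c <= 2)%N -> (0 < m)%N -> sorted geq la ->
  let coef := bra (fun n => Ediff c n) phi (nseq m 1%N) (ket vac (fun n => Ediff c n) la) in
  (forall d, d \in [:: m.-1; (m + c).-1] -> frobenius_form (2 * m + c).-1 d la ->
     coef = (-1) ^+ (m + sumn (legs la)) * (-1) ^+ (rk la).-1 *
       (if d == m.-1 then 1 else -1)) /\
  ((forall d, d \in [:: m.-1; (m + c).-1] -> ~ frobenius_form (2 * m + c).-1 d la) ->
     coef = 0).
Proof.
case/andP=> c0 c2 m0 la_sorted; rewrite /= (bra_ketE (Ediff c)).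
apply: braket_frobenius => //.
- by rewrite oppr_eq0 oner_eq0.
- exact: Ediff_anticomm.
- exact: dual_Ediff_flip.
- exact: Ediff_neg_vac.
- exact: Ediff_0_vac.
- exact: dual_phi.1.
Qed.

Lemma Estar_frobenius m la : (0 < m)%N -> sorted geq la ->
  let coef := bra (Estar a) phi (nseq m 1%N) (ket vac (Estar a) la) in
  (frobenius_form (2 * m).-1 m.-1 la ->
     coef = (-1) ^+ (m + sumn (legs la))) /\
  (~ frobenius_form (2 * m).-1 m.-1 la -> coef = 0).
Proof.
move=> m0 la_sorted; rewrite /= (bra_ketE (Estar a)).
have flip n v : phi (Estar a n v) = 1 * phi (Estar a (0%:Z - n) v).
  have -> : 0%:Z - n = - n by lia.
  rewrite [RHS]mul1r; symmetry; exact: dual_Estar_opp.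
have c2 : 0%N = 2%N -> 1 = -1 :> F by [].
have [form not_form] := braket_frobenius (X := Estar a) F0 (leq0n 2) (oner_neq0 F) c2
  Estar_anticomm flip Estar_neg_vac Estar_0_vac dual_phi.1 m0 la_sorted.
rewrite !addn0 in form not_form; split=> [la_form|la_not].
  by rewrite (form m.-1) // ?mem_head // expr1n eqxx !mulr1.
by apply: not_form => d; rewrite !inE orbb => /eqP ->.
Qed.

End Vertex.

Unset Implicit Arguments.
(* The quotients by 2 and the subtractions in the exponents are exact in the
   cases where they are used. *)
Theorem lemma5p1 (F : fieldType) (F0 : [pchar F] =i pred0)
    (M : lmodType F) (a : int -> {linear M -> M}) (vac : M)
    (phi : {linear M -> F^o})
    (fockM : fock_space a vac) (dual_phi : dual_vacuum a vac phi)
    (m : nat) (m_gt0 : (0 < m)%N)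
    (la : seq nat) (la_part : sorted geq la) :
  let eta := nseq m 1%N in
  let so := bra (Ustar a) phi eta (ket vac (Ustar a) la) in
  let sp := bra (Ystar a) phi eta (ket vac (Ystar a) la) in
  let o := bra (Wstar a) phi eta (ket vac (Wstar a) la) in
  [/\ (forall delta : nat, delta \in [:: 0; 1]%N ->
         frobenius_form (2 * m) (m - delta) la ->
         so = (-1) ^+ ((sumn la + rk la - delta - m)./2 + m * rk la)) /\
      ((forall delta : nat, delta \in [:: 0; 1]%N ->
         ~ frobenius_form (2 * m) (m - delta) la) -> so = 0),
      (frobenius_form (2 * m + 1) (m + 1) la \/
       frobenius_form (2 * m + 1) (m - 1) la ->
         sp = (-1) ^+ ((sumn la - m)./2 + m * rk la)) /\
      (~ (frobenius_form (2 * m + 1) (m + 1) la \/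
          frobenius_form (2 * m + 1) (m - 1) la) -> sp = 0) &
      (frobenius_form (2 * m - 1) (m - 1) la ->
         o = (-1) ^+ ((sumn la - m)./2 + m * rk la)) /\
      (~ frobenius_form (2 * m - 1) (m - 1) la -> o = 0)].
Proof.
move=> eta so sp o; have signE n k : (-1) ^+ (n + 2 * k) = (-1) ^+ n :> F.
  by rewrite exprD exprM sqrrN expr1n expr1n mulr1.
split.
- have [form not_form] := Ediff_frobenius F0 fockM dual_phi (c := 1) isT m_gt0 la_part.
  rewrite (_ : (2 * m + 1).-1 = 2 * m)%N in form not_form; last by lia.
  split=> [delta delta01 la_form|la_not].
    have [rk0 sumn_la] := sumn_frobenius_form la_part la_form.
    have delta_le1 : (delta <= 1)%N by move: delta01; rewrite !inE; lia.
    have dP : (m - delta)%N \in [:: m.-1; (m + 1).-1] by rewrite !inE; lia.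
    apply: (etrans (form _ dP la_form)); rewrite sumn_la.
    (* [delta = 1] is the unreflected case [d = m - 1]; [delta = 0] is the one with the extra
       reflection. *)
    have -> : (if (m - delta)%N == m.-1 then 1 else -1) = (-1) ^+ (1 - delta) :> F.
      case: eqP => dm; first by have -> : delta = 1%N by lia.
      by have -> : delta = 0%N by lia.
    rewrite -!exprD; case: (rk la) rk0 => // r _ /=.
    rewrite (_ : _ - delta - m = (sumn (legs la) + m * r + r + 1 - delta).*2)%N; last by lia.
    (* With [rk la = r + 1], the two exponents differ by the even number 2mr. *)
    rewrite doubleK -(signE _ (m * r)%N); congr (_ ^+ _); lia.
  apply: not_form => d; rewrite !inE => dm la_form.
  (* Here [d] is [m - 1] or [m], so [delta] is recovered as [m - d]. *)
  by apply: (la_not (m - d)%N); rewrite ?inE; rewrite ?subKn //; lia.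
- have [form not_form] := Ediff_frobenius F0 fockM dual_phi (c := 2) isT m_gt0 la_part.
  rewrite (_ : (2 * m + 2).-1 = 2 * m + 1)%N in form not_form; last by lia.
  split=> [la_form|la_not].
    have [d [dP {}la_form]] : exists d,
        (d = m.-1 \/ d = m + 1)%N /\ frobenius_form (2 * m + 1) d la.
      case: la_form => la_form; [exists (m + 1)%N | exists (m - 1)%N]; split=> //; lia.
    have [rk0 sumn_la] := sumn_frobenius_form la_part la_form.
    have dm : d \in [:: m.-1; (m + 2).-1] by rewrite !inE; lia.
    apply: (etrans (form _ dm la_form)); rewrite sumn_la; case: (rk la) rk0 => // r _ /=.
    have -> : (if d == m.-1 then 1 else -1) = (-1) ^+ (d != m.-1) :> F by case: eqP.
    rewrite -!exprD.
    rewrite (_ : _ - m = (sumn (legs la) + m * r + r + (d != m.-1)).*2)%N; last by lia.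
    rewrite doubleK -(signE _ (m * r)%N); congr (_ ^+ _); lia.
  apply: not_form => d; rewrite !inE => dm la_form; apply: la_not.
  case/orP: dm => /eqP dE; [right | left].
    by rewrite subn1 -dE.
  by rewrite (_ : (m + 1)%N = d) // dE; lia.
have [form not_form] := Estar_frobenius F0 fockM dual_phi m_gt0 la_part.
rewrite !subn1; split=> [la_form|//].
have [rk0 sumn_la] := sumn_frobenius_form la_part la_form.
apply: (etrans (form la_form)); rewrite sumn_la; case: (rk la) rk0 => // r _ /=.
rewrite (_ : _ - m = (sumn (legs la) + m * r).*2)%N; last first.
  (* The truncated predecessor is undone because [m] is positive. *)
  have -> : (2 * m).-1.+1 = (2 * m)%N by lia.
  lia.
rewrite doubleK -(signE _ (m * r)%N); congr (_ ^+ _); lia.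
Qed.
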